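(* Let $A$ be a commutative ring, $E$ an $A$-module, $R = A\ltimes E$ the trivial ring extension of $A$ by $E$, and let $M$ be an $A$-module. Then: (1)(a) Suppose that $\mathrm{pd}_A(E)<\infty$. If $M$ is a strongly Gorenstein projective $A$-module, then $M\otimes_A R$ is a strongly Gorenstein projective $R$-module. (1)(b) Conversely, suppose that $E$ is a flat $A$-module. If $M\otimes_A R$ is a strongly Gorenstein projective $R$-module, then $M$ is a strongly Gorenstein projective $A$-module. (2) Suppose that $\mathrm{Ext}_A^p(R,M)=0$ for all $p\geq 1$ and $\mathrm{fd}_A(R)<\infty$. If $M$ is a strongly Gorenstein injective $A$-module, then $\mathrm{Hom}_A(R,M)$ is a strongly Gorenstein injective $R$-module.
   Context: All rings are commutative with identity and all modules are unital. $\mathrm{pd}$ and $\mathrm{fd}$ denote projective and flat dimension. The trivial ring extension $A\ltimes E$ of a ring $A$ by an $A$-module $E$ is the ring with underlying additive group $A\times E$ and multiplication $(a,e)(a',e')=(aa',ae'+a'e)$; it is an $A$-algebra via $a\mapsto(a,0)$. Let $S$ be a ring. An $S$-module $N$ is strongly Gorenstein projective if there are a projective $S$-module $P$ and an endomorphism $f:P\to P$ such that the complex $\cdots\xrightarrow{f}P\xrightarrow{f}P\xrightarrow{f}P\xrightarrow{f}\cdots$ is exact, $N\cong\mathrm{Im}(f)$, and the complex remains exact after applying $\mathrm{Hom}_S(-,Q)$ for every projective $S$-module $Q$. Dually, $N$ is strongly Gorenstein injective if there are an injective $S$-module $I$ and an endomorphism $f:I\to I$ such that $\cdots\xrightarrow{f}I\xrightarrow{f}I\xrightarrow{f}I\xrightarrow{f}\cdots$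 is exact, $N\cong\mathrm{Im}(f)$, and the complex remains exact after applying $\mathrm{Hom}_S(J,-)$ for every injective $S$-module $J$. *)

(* Defs.v *)
From HB Require Import structures.
From mathcomp Require Import all_boot all_order all_algebra generic_quotient finmap.
From mathcomp Require Import boolp classical_sets functions cardinality fsbigop.

Set Implicit Arguments.
Unset Strict Implicit.
Unset Printing Implicit Defensive.

Import GRing.Theory.
Local Open Scope ring_scope.
Local Open Scope quotient_scope.

(* Rings are [comPzRingType] and not [comNzRingType], so that the zero ring is
   allowed, as in "commutative ring with identity". *)

Section LinearMaps.
Variables (A : comPzRingType) (U V : lmodType A).
Implicit Types f g h : {linear U -> V}.

Lemma linear_ext f g : f =1 g -> f = g.
Proof.
case: f g => f [[f1] [f2]] [g [[g1] [g2]]] /= /funext fg.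
case: g / fg g1 g2 => g1 g2.
by rewrite (Prop_irrelevance f1 g1) (Prop_irrelevance f2 g2).
Qed.

HB.instance Definition _ := gen_eqMixin {linear U -> V}.
HB.instance Definition _ := gen_choiceMixin {linear U -> V}.

Definition lin_zero : {linear U -> V} := \0.
Definition lin_add f g : {linear U -> V} := f \+ g.
Definition lin_opp f : {linear U -> V} := \- f.
Definition lin_scale (a : A) f : {linear U -> V} := a \*: f.

Fact lin_addA : associative lin_add.
Proof. by move=> f g h; apply: linear_ext => x /=; rewrite addrA. Qed.
Fact lin_addC : commutative lin_add.
Proof. by move=> f g; apply: linear_ext => x /=; rewrite addrC. Qed.
Fact lin_add0 : left_id lin_zero lin_add.
Proof. by move=> f; apply: linear_ext => x /=; rewrite add0r. Qed.
Fact lin_addN : left_inverse lin_zero lin_opp lin_add.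
Proof. by move=> f; apply: linear_ext => x /=; rewrite addNr. Qed.

HB.instance Definition _ := GRing.isZmodule.Build {linear U -> V}
  lin_addA lin_addC lin_add0 lin_addN.

Fact lin_scaleA a b f : lin_scale a (lin_scale b f) = lin_scale (a * b) f.
Proof. by apply: linear_ext => x /=; rewrite scalerA. Qed.
Fact lin_scale1 : left_id 1 lin_scale.
Proof. by move=> f; apply: linear_ext => x /=; rewrite scale1r. Qed.
Fact lin_scaleDr : right_distributive lin_scale +%R.
Proof. by move=> a f g; apply: linear_ext => x /=; rewrite scalerDr. Qed.
Fact lin_scaleDl f : {morph lin_scale^~ f : a b / a + b}.
Proof. by move=> a b; apply: linear_ext => x /=; rewrite scalerDl. Qed.

HB.instance Definition _ := GRing.Zmodule_isLmodule.Build A {linear U -> V}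
  lin_scaleA lin_scale1 lin_scaleDr lin_scaleDl.

Lemma lin_addE f g x : (f + g) x = f x + g x. Proof. by []. Qed.
Lemma lin_scaleE a f x : (a *: f) x = a *: f x. Proof. by []. Qed.

End LinearMaps.

Section Composition.
Variables (A : comPzRingType) (U V W : lmodType A).

Definition precomp (f : {linear U -> V}) (g : {linear V -> W}) :
  {linear U -> W} := g \o f.
Definition postcomp (f : {linear V -> W}) (g : {linear U -> V}) :
  {linear U -> W} := f \o g.

Fact precomp_linear f : linear (precomp f).
Proof. by move=> a g h; apply: linear_ext. Qed.
HB.instance Definition _ f := GRing.isLinear.Build A {linear V -> W}
  {linear U -> W} *:%R (precomp f) (precomp_linear f).

Fact postcomp_linear f : linear (postcomp f).
Proof. by move=> a g h; apply: linear_ext => x /=; rewrite linearP. Qed.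
HB.instance Definition _ f := GRing.isLinear.Build A {linear U -> V}
  {linear U -> W} *:%R (postcomp f) (postcomp_linear f).

End Composition.
Arguments precomp {A U V} W f g.
Arguments postcomp {A} U {V W} f g.

Record submodule (A : comPzRingType) (V : lmodType A) := Submodule {
  submodule_pred :> {pred V};
  submodule_closed : submod_closed submodule_pred
}.

HB.instance Definition _ (A : comPzRingType) (V : lmodType A)
    (S : submodule V) :=
  GRing.isSubmodClosed.Build A V (submodule_pred S)
    (GRing.submod_closed_semi (submodule_closed S)).

Section Submodules.
Variables (A : comPzRingType) (V : lmodType A).

Definition submod_type (S : submodule V) : Type := {x : V | x \in S}.

HB.instance Definition _ (S : submodule V) := [isSub of submod_type S for sval].
HB.instance Definition _ (S : submodule V) := [Choice of submod_type S by <:].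
HB.instance Definition _ (S : submodule V) :=
  [SubChoice_isSubLmodule of submod_type S by <:].

Definition submod_elt (S : submodule V) (x : V) (xS : x \in S) : submod_type S :=
  exist (fun y => y \in S) x xS.

Definition submod_incl (S : submodule V) : {linear submod_type S -> V} := \val.

Lemma submod_incl_eq0 (S : submodule V) (x : submod_type S) :
  (x == 0) = (submod_incl S x == 0).
Proof. by apply/eqP/eqP => [->|x0]; [exact: linear0|exact: val_inj]. Qed.

Fact span_closed (G : set V) : submod_closed
  [pred x : V | `[< forall S : submodule V, (forall g, G g -> g \in S) -> x \in S >]].
Proof.
split=> [|a x y]; first by apply/asboolP => S _; exact: rpred0.
move=> /asboolP xG /asboolP yG; apply/asboolP => S GS.
by rewrite rpredD ?rpredZ ?xG ?yG.
Qed.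
Definition span (G : set V) : submodule V := Submodule (span_closed G).

Lemma span_gen (G : set V) x : G x -> x \in span G.
Proof. by move=> Gx; apply/asboolP => S; apply. Qed.

Lemma span_ind (G : set V) (S : submodule V) :
  (forall g, G g -> g \in S) -> {subset span G <= S}.
Proof. by move=> GS x /asboolP; apply. Qed.

Definition quotmod (S : submodule V) : Type := Quotient.quot S.

HB.instance Definition _ S := GRing.Zmodule.on (quotmod S).

Definition quot_proj (S : submodule V) (x : V) : quotmod S :=
  \pi_(Quotient.quot S) x.

Section Quotient.
Variable S : submodule V.

Lemma quot_projP x y : quot_proj S x = quot_proj S y <-> x - y \in S.
Proof. by rewrite Quotient.idealrBE; split=> /eqP. Qed.

Lemma quot_proj_surj (q : quotmod S) : exists x, quot_proj S x = q.
Proof. by exists (repr (q : Quotient.quot S)); exact: reprK. Qed.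

Definition quot_scale (a : A) (q : quotmod S) : quotmod S :=
  quot_proj S (a *: repr (q : Quotient.quot S)).

Fact quot_projB : {morph quot_proj S : x y / x - y}.
Proof. exact: raddfB. Qed.

Lemma quot_scaleE a x : quot_scale a (quot_proj S x) = quot_proj S (a *: x).
Proof.
apply/quot_projP; rewrite -scalerBr rpredZ//.
by apply/quot_projP; exact: reprK.
Qed.

Fact quot_projD : {morph quot_proj S : x y / x + y}.
Proof. exact: raddfD. Qed.

Fact quot_scaleA a b q : quot_scale a (quot_scale b q) = quot_scale (a * b) q.
Proof. by have [x <-] := quot_proj_surj q; rewrite !quot_scaleE scalerA. Qed.
Fact quot_scale1 : left_id 1 quot_scale.
Proof. by move=> q; have [x <-] := quot_proj_surj q; rewrite quot_scaleE scale1r. Qed.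
Fact quot_scaleDr : right_distributive quot_scale +%R.
Proof.
move=> a q r; have [[x <-] [y <-]] := (quot_proj_surj q, quot_proj_surj r).
by rewrite -quot_projD !quot_scaleE scalerDr quot_projD.
Qed.
Fact quot_scaleDl q : {morph quot_scale^~ q : a b / a + b}.
Proof.
by move=> a b; have [x <-] := quot_proj_surj q; rewrite !quot_scaleE scalerDl quot_projD.
Qed.

HB.instance Definition _ := GRing.Zmodule_isLmodule.Build A (quotmod S)
  quot_scaleA quot_scale1 quot_scaleDr quot_scaleDl.

Fact quot_proj_linear : linear (quot_proj S).
Proof. by move=> a x y; rewrite quot_projD -quot_scaleE. Qed.
HB.instance Definition _ :=
  GRing.isLinear.Build A V (quotmod S) *:%R (quot_proj S) quot_proj_linear.

Lemma quot_proj_eq0 x : quot_proj S x = 0 <-> x \in S.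
Proof. by rewrite -(linear0 (quot_proj S)) quot_projP subr0. Qed.

Section Lift.
Variables (W : lmodType A) (f : {linear V -> W}).
Hypothesis fS : forall x, x \in S -> f x = 0.

Definition quot_lift_fun (q : quotmod S) : W := f (repr (q : Quotient.quot S)).

Lemma quot_lift_funE x : quot_lift_fun (quot_proj S x) = f x.
Proof.
apply/eqP; rewrite -subr_eq0 -linearB fS//.
by apply/quot_projP; exact: reprK.
Qed.

Fact quot_lift_linear : linear quot_lift_fun.
Proof.
move=> a q r; have [[x <-] [y <-]] := (quot_proj_surj q, quot_proj_surj r).
by rewrite -linearP !quot_lift_funE linearP.
Qed.
HB.instance Definition _ := GRing.isLinear.Build A (quotmod S) W *:%R
  quot_lift_fun quot_lift_linear.
Definition quot_lift : {linear quotmod S -> W} := quot_lift_fun.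

Lemma quot_liftE x : quot_lift (quot_proj S x) = f x.
Proof. exact: quot_lift_funE. Qed.

End Lift.
End Quotient.
End Submodules.

Section KernelImage.
Variables (A : comPzRingType) (U V : lmodType A).

Fact ker_closed (f : {linear U -> V}) : submod_closed [pred x | f x == 0].
Proof.
split=> [|a x y]; first by rewrite inE linear0.
by rewrite !inE linearP => /eqP-> /eqP->; rewrite scaler0 addr0.
Qed.
Definition ker (f : {linear U -> V}) : submodule U := Submodule (ker_closed f).

Fact im_closed (f : {linear U -> V}) :
  submod_closed [pred y | `[< exists x, f x = y >]].
Proof.
split=> [|a x y]; first by apply/asboolP; exists 0; rewrite linear0.
move=> /asboolP[u <-] /asboolP[v <-].
by apply/asboolP; exists (a *: u + v); rewrite linearP.
Qed.
Definition im (f : {linear U -> V}) : submodule V := Submodule (im_closed f).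

Fact preim_closed (f : {linear U -> V}) (S : submodule V) :
  submod_closed [pred x | f x \in S].
Proof.
split=> [|a x y]; first by rewrite inE linear0 rpred0.
by rewrite !inE linearP => *; rewrite rpredD ?rpredZ.
Qed.
Definition preim_submod (f : {linear U -> V}) (S : submodule V) : submodule U :=
  Submodule (preim_closed f S).

End KernelImage.

Definition is_zero (A : comPzRingType) (V : lmodType A) : Prop :=
  forall x : V, x = 0.

Definition isomorphic (A : comPzRingType) (U V : lmodType A) : Prop :=
  exists f : {linear U -> V}, bijective f.

Definition surj_map (A B : Type) (f : A -> B) : Prop :=
  forall y, exists x, f x = y.

(* Exactness at V of  U -- f --> V -- g --> W *)
Definition exact_at (A : comPzRingType) (U V W : lmodType A)
    (f : {linear U -> V}) (g : {linear V -> W}) : Prop := im f =i ker g.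

(* Homology at V of  U -- f --> V -- g --> W *)
Definition homology (A : comPzRingType) (U V W : lmodType A)
    (f : {linear U -> V}) (g : {linear V -> W}) : lmodType A :=
  quotmod (preim_submod (submod_incl (ker g)) (im f)).

Section FreeModule.
Variables (A : comPzRingType) (X : choiceType).

Fact finsupp_closed :
  submod_closed [pred f : X -> A^o | `[< finite_set [set x | f x != 0] >]].
Proof.
split=> [|a f g].
  by apply/asboolP; apply: (sub_finite_set _ (finite_set0 X)) => x /=; rewrite eqxx.
move=> /asboolP ff /asboolP fg; apply/asboolP.
have fU : finite_set ([set x | f x != 0] `|` [set x | g x != 0])%classic.
  by rewrite finite_setU.
apply: sub_finite_set fU => x /= fgx.
have [fx|] := eqVneq (f x) 0; last by left.
by right; apply: contra_neq fgx => gx; rewrite !fctE fx gx scaler0 addr0.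
Qed.
Definition finsupp : submodule (X -> A^o) := Submodule finsupp_closed.

Definition freemod : lmodType A := submod_type finsupp.

Definition free_coef (u : freemod) : X -> A := \val u.
Definition free_supp (u : freemod) : set X := [set x | free_coef u x != 0].

Lemma free_supp_finite u : finite_set (free_supp u).
Proof. by have /asboolP := valP u. Qed.

Fact free_gen_subproof (x : X) :
  (fun y => (y == x)%:R : A^o) \in finsupp.
Proof.
apply/asboolP; apply: (sub_finite_set _ (finite_set1 x)) => y /=.
by have [->|_] := eqVneq y x; rewrite // mulr0n eqxx.
Qed.
Definition free_gen (x : X) : freemod :=
  submod_elt (free_gen_subproof x).

Lemma free_coef_linear a u v x :
  free_coef (a *: u + v) x = a * free_coef u x + free_coef v x.
Proof. by []. Qed.

Section Lift.
Variables (V : lmodType A) (g : X -> V).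

Definition free_lift_fun (u : freemod) : V :=
  \sum_(x \in free_supp u) free_coef u x *: g x.

Lemma free_lift_funE (D : set X) u : finite_set D -> (free_supp u `<=` D)%classic ->
  free_lift_fun u = \sum_(x <- fset_set D) free_coef u x *: g x.
Proof.
move=> fD uD; rewrite -(fsbig_finite _ _ fD); apply: fsbig_widen => // x [_ /= /negP].
by rewrite negbK => /eqP->; rewrite scale0r.
Qed.

Fact free_lift_linear : linear free_lift_fun.
Proof.
move=> a u v; pose D := (free_supp u `|` free_supp v)%classic.
have fD : finite_set D by rewrite finite_setU; split; exact: free_supp_finite.
rewrite !(@free_lift_funE D)//.
- rewrite scaler_sumr -big_split; apply: eq_bigr => x _ /=.
  by rewrite free_coef_linear scalerDl scalerA.
- by move=> x; right.
- by move=> x; left.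
move=> x; rewrite /D /free_supp /= free_coef_linear.
by have [->|] := eqVneq (free_coef u x) 0; [rewrite mulr0 add0r; right|left].
Qed.
HB.instance Definition _ := GRing.isLinear.Build A freemod V *:%R
  free_lift_fun free_lift_linear.
Definition free_lift : {linear freemod -> V} := free_lift_fun.

Lemma free_lift_gen x : free_lift (free_gen x) = g x.
Proof.
have -> : free_lift (free_gen x) = \sum_(y <- fset_set [set x]%classic)
    free_coef (free_gen x) y *: g y.
  apply: free_lift_funE => // y; rewrite /free_supp /free_coef/=.
  by have [->|_] := eqVneq y x; rewrite // mulr0n eqxx.
by rewrite fset_set1 big_seq_fset1 /free_coef/= eqxx scale1r.
Qed.

End Lift.

Lemma free_ext (V : lmodType A) (f h : {linear freemod -> V}) :
  (forall x, f (free_gen x) = h (free_gen x)) -> f =1 h.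
Proof.
move=> fh u.
have -> : u = \sum_(x <- fset_set (free_supp u)) free_coef u x *: free_gen x.
  apply: val_inj; rewrite raddf_sum; apply/funext => y /=.
  rewrite fct_sumE.
  have [yu|yu] := boolP (y \in fset_set (free_supp u)).
    rewrite (big_rem y)//= big_seq big1 ?addr0.
      by rewrite fctE/= eqxx [RHS]mulr1.
    move=> x; rewrite mem_rem_uniq ?fset_uniq// inE => /andP[/negPf xy _].
    by rewrite fctE/= eq_sym xy [LHS]mulr0.
  rewrite big_seq big1 => [|x xu].
    move: yu; rewrite in_fset_set; last exact: free_supp_finite.
    by rewrite notin_setE /free_supp/= => /negP; rewrite negbK => /eqP.
  rewrite fctE/=; case: eqVneq => [yx|_]; last by rewrite [LHS]mulr0.
  by rewrite yx xu in yu.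
by rewrite !linear_sum; apply: eq_bigr => x _; rewrite !linearZ_LR fh.
Qed.

End FreeModule.

Definition bilinear_map (A : comPzRingType) (M N V : lmodType A)
    (b : M -> N -> V) : Prop :=
  (forall m, linear (b m)) /\ (forall n, linear (b^~ n)).

Section Tensor.
Variables (A : comPzRingType) (M N : lmodType A).

Let gen (m : M) (n : N) : freemod A (M * N)%type := free_gen A (m, n).

Inductive tensor_relator : freemod A (M * N)%type -> Prop :=
| TensorAddl m m' n : tensor_relator (gen (m + m') n - gen m n - gen m' n)
| TensorAddr m n n' : tensor_relator (gen m (n + n') - gen m n - gen m n')
| TensorScalel a m n : tensor_relator (gen (a *: m) n - a *: gen m n)
| TensorScaler a m n : tensor_relator (gen m (a *: n) - a *: gen m n).

Definition tensor : lmodType A := quotmod (span tensor_relator).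

Definition tens (m : M) (n : N) : tensor := quot_proj _ (gen m n).

Lemma tensDl m m' n : tens (m + m') n = tens m n + tens m' n.
Proof.
apply/eqP; rewrite -subr_eq0 opprD addrA -!linearB; apply/eqP/quot_proj_eq0.
exact/span_gen/TensorAddl.
Qed.
Lemma tensDr m n n' : tens m (n + n') = tens m n + tens m n'.
Proof.
apply/eqP; rewrite -subr_eq0 opprD addrA -!linearB; apply/eqP/quot_proj_eq0.
exact/span_gen/TensorAddr.
Qed.
Lemma tensZl a m n : tens (a *: m) n = a *: tens m n.
Proof.
apply/eqP; rewrite -subr_eq0 -linearZ_LR -linearB; apply/eqP/quot_proj_eq0.
exact/span_gen/TensorScalel.
Qed.
Lemma tensZr a m n : tens m (a *: n) = a *: tens m n.
Proof.
apply/eqP; rewrite -subr_eq0 -linearZ_LR -linearB; apply/eqP/quot_proj_eq0.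
exact/span_gen/TensorScaler.
Qed.

Lemma tens_bilinear : bilinear_map tens.
Proof.
by split=> [m a n n'|n a m m'] /=; rewrite ?tensDl ?tensDr ?tensZl ?tensZr.
Qed.

Section Lift.
Variables (V : lmodType A) (b : M -> N -> V).
Hypothesis bB : bilinear_map b.

Let bfree : {linear freemod A (M * N)%type -> V} :=
  free_lift (fun p => b p.1 p.2).

Fact tensor_lift_subproof x : x \in span tensor_relator -> bfree x = 0.
Proof.
move=> xS; suff: x \in ker bfree by rewrite inE => /eqP.
apply: span_ind x xS => r rr; rewrite inE; apply/eqP.
have bDl m m' n : b (m + m') n = b m n + b m' n.
  by have := bB.2 n 1 m m'; rewrite /= !scale1r.
have bDr m n n' : b m (n + n') = b m n + b m n'.
  by have := bB.1 m 1 n n'; rewrite /= !scale1r.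
have b0l n : b 0 n = 0 by apply: (addrI (b 0 n)); rewrite -bDl !addr0.
have b0r m : b m 0 = 0 by apply: (addrI (b m 0)); rewrite -bDr !addr0.
case: rr => [m m' n|m n n'|a m n|a m n]; rewrite !linearB ?linearZ_LR /= !free_lift_gen /=.
- by rewrite bDl addrAC addrK subrr.
- by rewrite bDr addrAC addrK subrr.
- by have := bB.2 n a m 0; rewrite /= b0l !addr0 => ->; rewrite scalerN subrr.
- by have := bB.1 m a n 0; rewrite /= b0r !addr0 => ->; rewrite scalerN subrr.
Qed.

Definition tensor_lift : {linear tensor -> V} := quot_lift tensor_lift_subproof.

Lemma tensor_liftE m n : tensor_lift (tens m n) = b m n.
Proof. by rewrite /tensor_lift /tens quot_liftE free_lift_gen. Qed.

End Lift.

Lemma tensor_ext (V : lmodType A) (f g : {linear tensor -> V}) :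
  (forall m n, f (tens m n) = g (tens m n)) -> f =1 g.
Proof.
move=> fg t; have [u <-] := quot_proj_surj t.
have := @free_ext _ _ _ (precomp V (quot_proj (span tensor_relator)) f)
  (precomp V (quot_proj (span tensor_relator)) g).
by apply=> -[m n]; exact: fg.
Qed.

End Tensor.

Section TensorMap.
Variables (A : comPzRingType) (M M' : lmodType A) (u : {linear M -> M'}).
Variable (N : lmodType A).

Fact tensor_map_subproof : bilinear_map (fun (m : M) (n : N) => tens (u m) n).
Proof.
by split=> [m a n n'|n a m m'] /=; rewrite ?linearP ?tensDl ?tensDr ?tensZl ?tensZr.
Qed.

(* u (x) id_N *)
Definition tensor_map : {linear tensor M N -> tensor M' N} :=
  tensor_lift tensor_map_subproof.

End TensorMap.

(* An R-module seen as an A-module through phi; [restrict phi R^o] is R itself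
   as an A-module. *)
Definition restrict (A R : comPzRingType) (phi : {rmorphism A -> R})
  (N : lmodType R) : Type := N.

Section ChangeOfRings.
Variables (A R : comPzRingType) (phi : {rmorphism A -> R}).

Section Restriction.
Variable N : lmodType R.

Notation restrict := (restrict phi N).

HB.instance Definition _ := GRing.Zmodule.copy restrict N.

Let rscale (a : A) (x : restrict) : restrict := phi a *: (x : N).

Fact restrict_scaleA a b x : rscale a (rscale b x) = rscale (a * b) x.
Proof. by rewrite /rscale scalerA rmorphM. Qed.
Fact restrict_scale1 : left_id 1 rscale.
Proof. by move=> x; rewrite /rscale rmorph1 scale1r. Qed.
Fact restrict_scaleDr : right_distributive rscale +%R.
Proof. by move=> a x y; rewrite /rscale scalerDr. Qed.
Fact restrict_scaleDl x : {morph rscale^~ x : a b / a + b}.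
Proof. by move=> a b; rewrite /rscale rmorphD scalerDl. Qed.
HB.instance Definition _ := GRing.Zmodule_isLmodule.Build A restrict
  restrict_scaleA restrict_scale1 restrict_scaleDr restrict_scaleDl.

Lemma restrict_scaleE (a : A) (x : restrict) : a *: x = phi a *: (x : N).
Proof. by []. Qed.

End Restriction.

(* M (x)_A R, with r (m (x) s) = m (x) rs *)
Section BaseChange.
Variable M : lmodType A.

Let RA : lmodType A := restrict phi R^o.

Definition base_change : Type := tensor M RA.
HB.instance Definition _ := GRing.Zmodule.on base_change.

Fact base_change_act_subproof (r : R) :
  bilinear_map (fun (m : M) (s : RA) => tens m (r * (s : R) : RA)).
Proof.
split=> [m a s s'|s a m m'] /=; last by rewrite tensDl tensZl.
rewrite -tensZr -tensDr; congr tens; rewrite /RA restrict_scaleE.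
by rewrite mulrDr mulrCA.
Qed.

Definition base_change_act (r : R) : {linear tensor M RA -> tensor M RA} :=
  tensor_lift (base_change_act_subproof r).

Lemma base_change_actE r m (s : RA) :
  base_change_act r (tens m s) = tens m (r * (s : R) : RA).
Proof. exact: tensor_liftE. Qed.

Let bscale (r : R) (t : base_change) : base_change := base_change_act r t.

Fact base_change_scaleA r s t : bscale r (bscale s t) = bscale (r * s) t.
Proof.
apply: (@tensor_ext _ _ _ _ (postcomp _ (base_change_act r) (base_change_act s))
  (base_change_act (r * s))) => m x.
by rewrite base_change_actE -mulrA -!base_change_actE.
Qed.
Fact base_change_scale1 : left_id 1 bscale.
Proof.
move=> t; apply: (@tensor_ext _ _ _ _ (base_change_act 1) idfun) => m x.
by rewrite base_change_actE mul1r.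
Qed.
Fact base_change_scaleDr : right_distributive bscale +%R.
Proof. by move=> r x y; rewrite /bscale linearD. Qed.
Fact base_change_scaleDl t : {morph bscale^~ t : r s / r + s}.
Proof.
move=> r s; apply: (@tensor_ext _ _ _ _ (base_change_act (r + s))
  (base_change_act r + base_change_act s)) => m x.
by rewrite lin_addE !base_change_actE mulrDl tensDr.
Qed.
HB.instance Definition _ := GRing.Zmodule_isLmodule.Build R base_change
  base_change_scaleA base_change_scale1 base_change_scaleDr base_change_scaleDl.

Lemma base_change_scaleE (r : R) (m : M) (s : RA) :
  r *: (tens m s : base_change) = (tens m (r * (s : R) : RA) : base_change).
Proof. exact: base_change_actE. Qed.

End BaseChange.

(* Hom_A(R, M), with (r f)(s) = f(rs) *)
Section CoinducedModule.
Variable M : lmodType A.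

Let RA : lmodType A := restrict phi R^o.

Definition coinduced : Type := {linear RA -> M}.
HB.instance Definition _ := GRing.Zmodule.on coinduced.

Definition coinduced_act_fun (r : R) (f : coinduced) (s : RA) : M :=
  f (r * (s : R) : RA).

Fact coinduced_act_linear r f : linear (coinduced_act_fun r f).
Proof.
move=> a s s'; rewrite /coinduced_act_fun -linearP; congr (f _).
by rewrite /RA !restrict_scaleE mulrDr mulrCA.
Qed.
HB.instance Definition _ r f := GRing.isLinear.Build A RA M *:%R
  (coinduced_act_fun r f) (coinduced_act_linear r f).

Let cscale (r : R) (f : coinduced) : coinduced := coinduced_act_fun r f.

Fact coinduced_scaleA r s f : cscale r (cscale s f) = cscale (r * s) f.
Proof.
by apply: linear_ext => x; rewrite /= /coinduced_act_fun mulrCA mulrA.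
Qed.
Fact coinduced_scale1 : left_id 1 cscale.
Proof.
by move=> f; apply: linear_ext => x; rewrite /= /coinduced_act_fun mul1r.
Qed.
Fact coinduced_scaleDr : right_distributive cscale +%R.
Proof. by move=> r f g; apply: linear_ext. Qed.
Fact coinduced_scaleDl f : {morph cscale^~ f : r s / r + s}.
Proof.
move=> r s; apply: linear_ext => x.
by rewrite lin_addE /= /coinduced_act_fun mulrDl linearD.
Qed.
HB.instance Definition _ := GRing.Zmodule_isLmodule.Build R coinduced
  coinduced_scaleA coinduced_scale1 coinduced_scaleDr coinduced_scaleDl.

Lemma coinduced_scaleE (r : R) (f : coinduced) (s : RA) :
  (r *: f) s = f (r * (s : R) : RA).
Proof. by []. Qed.

End CoinducedModule.
End ChangeOfRings.

Section TrivialExtension.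
Variables (A : comPzRingType) (E : lmodType A).

Definition triv_ext : Type := (A * E)%type.
HB.instance Definition _ := GRing.Zmodule.copy triv_ext (A * E)%type.

Let tone : triv_ext := (1, 0).
Let tmul (x y : triv_ext) : triv_ext :=
  (x.1 * y.1, x.1 *: y.2 + y.1 *: x.2).

Fact triv_mulA : associative tmul.
Proof.
move=> [a e] [b f] [c g]; rewrite /tmul /= mulrA; congr pair.
by rewrite !scalerDr !scalerA addrA (mulrC c a) (mulrC c b).
Qed.
Fact triv_mulC : commutative tmul.
Proof. by move=> [a e] [b f]; rewrite /tmul /= mulrC addrC. Qed.
Fact triv_mul1 : left_id tone tmul.
Proof. by move=> [a e]; rewrite /tmul /= mul1r scale1r scaler0 addr0. Qed.
Fact triv_mulDl : left_distributive tmul +%R.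
Proof.
move=> [a e] [b f] [c g]; rewrite /tmul /=; congr pair => /=.
  by rewrite mulrDl.
by rewrite scalerDl scalerDr addrACA.
Qed.
HB.instance Definition _ := GRing.Zmodule_isComPzRing.Build triv_ext
  triv_mulA triv_mulC triv_mul1 triv_mulDl.

Definition triv_incl (a : A) : triv_ext := (a, 0).

Fact triv_incl_zmod : zmod_morphism triv_incl.
Proof. by move=> a b; congr pair; rewrite /= subrr. Qed.
Fact triv_incl_monoid : monoid_morphism triv_incl.
Proof.
by split=> // a b; congr pair; rewrite /= !scaler0 addr0.
Qed.
HB.instance Definition _ :=
  GRing.isZmodMorphism.Build A triv_ext triv_incl triv_incl_zmod.
HB.instance Definition _ :=
  GRing.isMonoidMorphism.Build A triv_ext triv_incl triv_incl_monoid.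

End TrivialExtension.

Section Classes.
Variable S : comPzRingType.

Definition projective (P : lmodType S) : Prop :=
  forall (X Y : lmodType S) (p : {linear X -> Y}) (f : {linear P -> Y}),
  surj_map p -> exists g : {linear P -> X}, p \o g =1 f.

Definition injective_module (I : lmodType S) : Prop :=
  forall (X Y : lmodType S) (i : {linear X -> Y}) (f : {linear X -> I}),
  injective i -> exists g : {linear Y -> I}, g \o i =1 f.

Definition flat (F : lmodType S) : Prop :=
  forall (X Y : lmodType S) (u : {linear X -> Y}),
  injective u -> injective (tensor_map u F).

Definition strongly_gorenstein_projective (N : lmodType S) : Prop :=
  exists (P : lmodType S) (f : {linear P -> P}),
  [/\ projective P,
      exact_at f f,
      isomorphic N (submod_type (im f)) &
      forall Q : lmodType S, projective Q ->
        exact_at (precomp Q f) (precomp Q f)].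

Definition strongly_gorenstein_injective (N : lmodType S) : Prop :=
  exists (I : lmodType S) (f : {linear I -> I}),
  [/\ injective_module I,
      exact_at f f,
      isomorphic N (submod_type (im f)) &
      forall J : lmodType S, injective_module J ->
        exact_at (postcomp J f) (postcomp J f)].

End Classes.

Section Resolutions.
Variables (A : comPzRingType) (X : lmodType A).

(* An exact complex ... -> C 1 -> C 0 -> X -> 0 *)
Record resolution := Resolution {
  res_mod :> nat -> lmodType A;
  res_diff : forall n, {linear res_mod n.+1 -> res_mod n};
  res_aug : {linear res_mod 0%N -> X};
  res_aug_surj : surj_map res_aug;
  res_exact0 : exact_at (res_diff 0%N) res_aug;
  res_exact : forall n, exact_at (res_diff n.+1) (res_diff n)
}.

Definition resolution_length_le (C : resolution) (n : nat) : Prop :=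
  forall i, (n < i)%N -> is_zero (C i).

Definition pd_le (n : nat) : Prop :=
  exists C : resolution,
    (forall i, projective (C i)) /\ resolution_length_le C n.

Definition fd_le (n : nat) : Prop :=
  exists C : resolution,
    (forall i, flat (C i)) /\ resolution_length_le C n.

Definition finite_pd : Prop := exists n, pd_le n.
Definition finite_fd : Prop := exists n, fd_le n.

End Resolutions.

(* The canonical free resolution: the n-th term is the free module on the
   underlying set of the n-th syzygy. *)
Section FreeResolution.
Variables (A : comPzRingType).

Definition free_cover (X : lmodType A) : {linear freemod A X -> X} :=
  free_lift (fun x : X => x).

Lemma free_cover_surj X : surj_map (free_cover X).
Proof. by move=> x; exists (free_gen A x); rewrite free_lift_gen. Qed.

Variable X : lmodType A.

Fixpoint syzygy (n : nat) : lmodType A :=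
  if n is n'.+1 then submod_type (ker (free_cover (syzygy n'))) else X.

Definition free_res_mod (n : nat) : lmodType A := freemod A (syzygy n).

Definition free_res_diff (n : nat) :
    {linear free_res_mod n.+1 -> free_res_mod n} :=
  postcomp _ (submod_incl (ker (free_cover (syzygy n))))
    (free_cover (syzygy n.+1)).

Fact free_res_im n :
  im (free_res_diff n) =i ker (free_cover (syzygy n)).
Proof.
move=> y; apply/asboolP/idP => [[x <-]|yK]; first exact: valP.
have [x xE] := free_cover_surj (submod_elt yK : syzygy n.+1).
by exists x; rewrite /= xE.
Qed.

Fact free_res_exact n : exact_at (free_res_diff n.+1) (free_res_diff n).
Proof.
move=> y; rewrite free_res_im.
exact: (submod_incl_eq0 (free_cover (syzygy n.+1) y)).
Qed.

Definition free_resolution : resolution X :=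
  @Resolution A X free_res_mod free_res_diff (free_cover X)
    (@free_cover_surj X) (@free_res_im 0%N) free_res_exact.

End FreeResolution.

Lemma freemod_projective (A : comPzRingType) (X : choiceType) :
  projective (freemod A X).
Proof.
move=> U V p f ps.
have [g gP] := choice (fun x => ps (f (free_gen A x))).
exists (free_lift g).
by apply: (@free_ext _ _ _ (postcomp _ p (free_lift g))) => x /=; rewrite free_lift_gen.
Qed.

(* Ext^p_A(X, M), as the p-th cohomology of Hom_A(C, M) for C the canonical free
   resolution of X. *)
Definition Ext (A : comPzRingType) (p : nat) (X M : lmodType A) : lmodType A :=
  let d n : {linear {linear free_resolution X n -> M} ->
                    {linear free_resolution X n.+1 -> M}} :=
    precomp M (res_diff (free_resolution X) n) in
  if p is n.+1 then homology (d n) (d n.+1) else submod_type (ker (d 0%N)).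

(* Main.v *)
(* A module N is strongly Gorenstein projective iff it sits in an exact sequence
   0 -> N -> P -> N -> 0 with P projective along which every map N -> Q with Q
   projective extends; dually for injectives. Since N is its own syzygy,
   Ext^k(N, -) and Tor_k(N, -) do not depend on k >= 1, so they vanish on modules
   of finite projective, resp. flat, dimension.
   (1a) Tor_1(M, E) = 0 keeps the sequence exact after base change. By adjunction,
   R-maps M (x) R -> Q extend because Q is, over A, a retract of some F (x) (A + E)
   with F projective, on which Ext^1(M, -) vanishes.
   (1b) For N = M (x)_A R, the module N (x)_R E = M (x)_A E embeds into N, i.e.
   Tor_1^R(N, A) = 0, so reducing the sequence modulo E gives
   0 -> M -> P/EP -> M -> 0 over A; a map M -> Q extends because its base change
   N -> Q (x) R does.
   (2) Ext^1(R, M) = 0 keeps the sequence exact after Hom_A(R, -). An injective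
   R-module J is a retract of some Hom_A(R, I') with I' injective over A; as
   Hom_A(F, I') is injective for flat F, J has finite injective dimension over A,
   whence Ext^1_A(J, M) = 0. *)
Require Import Defs.
From HB Require Import structures.
From mathcomp Require Import all_boot all_order all_algebra.
From mathcomp Require Import boolp classical_sets finmap cardinality.

Set Implicit Arguments.
Unset Strict Implicit.
Unset Printing Implicit Defensive.

Import GRing.Theory.
Local Open Scope ring_scope.

(** Bundles a function whose linearity is established only in the course of a proof, where no
    canonical instance can be declared. *)
Definition mklin (A : comPzRingType) (U V : lmodType A) (f : U -> V)
    (fP : linear f) : {linear U -> V} :=
  HB.pack f (GRing.isLinear.Build A U V *:%R f fP).

Definition restrict_lin (A R : comPzRingType) (phi : {rmorphism A -> R})
    (U V : lmodType R) (f : {linear U -> V}) :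
    {linear restrict phi U -> restrict phi V} :=
  @mklin A (restrict phi U) (restrict phi V) f (fun a x y => linearP f (phi a) x y).

Lemma postcompE (A : comPzRingType) (U V W : lmodType A) (f : {linear V -> W})
    (g : {linear U -> V}) x : postcomp U f g x = f (g x).
Proof. by []. Qed.

(** * Short exact sequences and one-step descriptions of strongly Gorenstein modules *)

Section ShortExact.
Variable A : comPzRingType.

(** Exactness in the middle is an equivalence on elements, ready to be used as a view in diagram
    chases. *)
Definition short_exact (U V W : lmodType A) (i : {linear U -> V})
    (p : {linear V -> W}) : Prop :=
  [/\ injective i, surj_map p & forall v, p v = 0 <-> exists u, i u = v].

Lemma inj_surj_bij (T T' : Type) (f : T -> T') :
  injective f -> surj_map f -> bijective f.
Proof.
move=> fI /choice[g fg]; exists g => // x.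
exact/fI/fg.
Qed.

Lemma linear_inj (U V : lmodType A) (f : {linear U -> V}) :
  (forall x, f x = 0 -> x = 0) -> injective f.
Proof.
move=> f0 x y fxy; apply/eqP; rewrite -subr_eq0; apply/eqP/f0.
by rewrite linearB fxy subrr.
Qed.

Lemma exact_atP (U V W : lmodType A) (f : {linear U -> V}) (g : {linear V -> W}) :
  exact_at f g <-> forall v, g v = 0 <-> exists u, f u = v.
Proof.
split=> [fg v|fg v]; last by rewrite !inE; apply/asboolP/eqP => /fg.
have E : `[< exists x, f x = v >] = (g v == 0) := fg v.
split=> [/eqP|fv]; first by rewrite -E => /asboolP.
by apply/eqP; rewrite -E; apply/asboolP.
Qed.

(** Chosen preimages depend linearly on [w], since injectivity of [i] makes them unique. *)
Lemma factor_inj (U V W : lmodType A) (i : {linear U -> V}) (h : {linear W -> V}) :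
  injective i -> (forall w, exists u, i u = h w) ->
  exists g : {linear W -> U}, forall w, i (g w) = h w.
Proof.
move=> iI /choice[g gP].
have gL : linear g by move=> a x y; apply: iI; rewrite linearP !gP linearP.
by exists (mklin gL).
Qed.

(** Composing [h] with a set-theoretic section of [p] gives a linear map, because [h] does not see
    the choice of preimages. *)
Lemma factor_surj (V W X : lmodType A) (p : {linear V -> W}) (h : {linear V -> X}) :
  surj_map p -> (forall v, p v = 0 -> h v = 0) ->
  exists g : {linear W -> X}, forall v, g (p v) = h v.
Proof.
move=> /choice[s sP] hp.
have E v : h (s (p v)) = h v.
  apply/eqP; rewrite -subr_eq0 -linearB; apply/eqP/hp.
  by rewrite linearB sP subrr.
have gL : linear (h \o s).
  by move=> a x y /=; rewrite -linearP -[RHS]E linearP !sP.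
by exists (mklin gL) => v; exact: E.
Qed.

(** Corestriction to the image; it serves to cut a resolution into short exact sequences. *)
Lemma short_exact_im (U V : lmodType A) (f : {linear U -> V}) :
  exists p : {linear U -> submod_type (im f)},
    [/\ forall u, submod_incl (im f) (p u) = f u, surj_map p &
        forall u, p u = 0 <-> f u = 0].
Proof.
have fP u : f u \in im f by apply/asboolP; exists u.
have pL : linear (fun u => submod_elt (fP u) : submod_type (im f)).
  by move=> a x y; apply: val_inj; exact: linearP.
exists (mklin pL); split=> [//|[y yP]|u].
  have /asboolP[x xy] := yP; exists x; exact: val_inj.
by split=> [/(congr1 (submod_incl (im f)))|fu]; [rewrite linear0|apply: val_inj].
Qed.

(** Dimension shifting as an induction principle: a resolution of finite length is cut at the images
    of its differentials, and [K] passes from each syzygy to the next module on its right. *)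
Lemma resolution_ind (cl K : lmodType A -> Prop) :
  (forall Z, is_zero Z -> K Z) ->
  (forall (U F X : lmodType A) (i : {linear U -> F}) (p : {linear F -> X}),
    short_exact i p -> cl F -> K U -> K X) ->
  forall (X : lmodType A) (C : resolution X) n,
    (forall i, cl (C i)) -> resolution_length_le C n -> K X.
Proof.
move=> K0 KS X C n Ccl Cn.
(* Here [m] counts the steps left before the end: for [m = 0] the image comes from [C n.+1], which
   is zero. *)
have KI m k : (k + m)%N = n -> K (submod_type (im (res_diff C k))).
  elim: m k => [|m IH] k.
    rewrite addn0 => kn; apply: K0 => -[y yP]; apply: val_inj => /=.
    have /asboolP[x <-] := yP.
    by rewrite (Cn k.+1 _ x) ?kn// linear0.
  rewrite addnS -addSn => /IH; have [p [pE pS p0]] := short_exact_im (res_diff C k).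
  apply: (KS _ _ _ (submod_incl _) p) => //; split=> //; first exact: val_inj.
  move=> v; rewrite p0.
  have /exact_atP-> := @res_exact _ _ C k.
  split=> [[u <-]|[[u uP] <-]]; last by have /asboolP[x xu] := uP; exists x.
  have uP : res_diff C k.+1 u \in im (res_diff C k.+1) by apply/asboolP; exists u.
  by exists (submod_elt uP).
apply: (KS _ _ _ (submod_incl (im (res_diff C 0%N))) (res_aug C)) => //; last exact: (KI n).
split; [exact: val_inj|exact: res_aug_surj|move=> v].
have /exact_atP-> := @res_exact0 _ _ C.
split=> [[u <-]|[[u uP] <-]]; last by have /asboolP[x xu] := uP; exists x.
have uP : res_diff C 0%N u \in im (res_diff C 0%N) by apply/asboolP; exists u.
by exists (submod_elt uP).
Qed.

(** Factoring [f] through its image yields [p]; the kernel of [p] is that of [f], which by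
    periodicity is the image of [i]. *)
Lemma exact_endo_split (N P : lmodType A) (f : {linear P -> P}) :
  exact_at f f -> isomorphic N (submod_type (im f)) ->
  exists (i : {linear N -> P}) (p : {linear P -> N}),
    short_exact i p /\ forall x, i (p x) = f x.
Proof.
move=> fe [th thb].
have thI := bij_inj thb; have [ht _ thK] := thb.
pose i : {linear N -> P} := postcomp _ (submod_incl (im f)) th.
have iI : injective i by move=> x y /val_inj/thI.
have iP v : (exists u, i u = v) <-> exists x, f x = v.
  split=> [[u <-]|[x <-]].
    by have /asboolP[x xu] := valP (th u); exists x; rewrite xu.
  have fxP : f x \in im f by apply/asboolP; exists x.
  by exists (ht (submod_elt fxP)); rewrite /= thK.
have [p pE] : exists p : {linear P -> N}, forall x, i (p x) = f x.
  by apply: factor_inj => // x; apply/iP; exists x.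
exists i, p; do 2!split=> //.
  move=> n; have /iP[x xE] : exists u, i u = i n by exists n.
  by exists x; apply: iI; rewrite pE.
move=> v; rewrite iP; have /exact_atP<- := fe.
split=> [pv|fv]; first by rewrite -pE pv linear0.
by apply: iI; rewrite pE linear0.
Qed.

Lemma short_exact_endo (N P : lmodType A) (i : {linear N -> P})
    (p : {linear P -> N}) : short_exact i p ->
  exact_at (postcomp P i p) (postcomp P i p) /\
  isomorphic N (submod_type (im (postcomp P i p))).
Proof.
move=> [iI pS ip]; split.
  apply/exact_atP => v /=; split=> [iv|[u <-]]; last first.
    by rewrite (_ : p (i _) = 0) ?linear0//; apply/ip; exists (p u).
  have /ip[u <-] : p v = 0 by apply: iI; rewrite iv linear0.
  by have [x <-] := pS u; exists x.
have iP n : i n \in im (postcomp P i p).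
  by apply/asboolP; have [x <-] := pS n; exists x.
have tL : linear (fun n => submod_elt (iP n) : submod_type (im (postcomp P i p))).
  by move=> a x y; apply: val_inj; exact: linearP.
exists (mklin tL); apply: inj_surj_bij.
  by move=> x y /(congr1 val)/iI.
by move=> [y yP]; have /asboolP[x xE] := yP; exists (p x); exact: val_inj.
Qed.

(** A map [P -> Q] killed by [f] vanishes on the image of [i], hence factors through [p] as some
    [N -> Q]; it is a coboundary exactly when this factor extends along [i]. *)
Lemma sgpP (N : lmodType A) : strongly_gorenstein_projective N <->
  exists (P : lmodType A) (i : {linear N -> P}) (p : {linear P -> N}),
  [/\ projective P, short_exact i p &
      forall (Q : lmodType A) (h : {linear N -> Q}), projective Q ->
        exists g : {linear P -> Q}, forall n, g (i n) = h n].
Proof.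
split=> [[P [f [Pp fe fN fQ]]]|[P [i [p [Pp ses iQ]]]]].
  have [i [p [ses ipE]]] := exact_endo_split fe fN; have [iI pS ip] := ses.
  exists P, i, p; split=> // Q h Qp.
  have /exact_atP/(_ (precomp Q p h)) := fQ Q Qp.
  case=> [[|g gE]].
    apply: linear_ext => x /=; rewrite -ipE.
    by rewrite (_ : p (i _) = 0) ?linear0//; apply/ip; exists (p x).
  exists g => n; have [x <-] := pS n; rewrite ipE.
  by have := congr1 (fun k : {linear P -> Q} => k x) gE.
have [iI pS ip] := ses; have [fe fN] := short_exact_endo ses.
exists P, (postcomp P i p); split=> // Q Qp.
have pi n : p (i n) = 0 by apply/ip; exists n.
apply/exact_atP => h; split=> [h0|[g <-]]; last first.
  by apply: linear_ext => x /=; rewrite pi !linear0.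
have hi n : h (i n) = 0.
  have [x <-] := pS n.
  by have := congr1 (fun k : {linear P -> Q} => k x) h0.
have [h' h'E] : exists h' : {linear N -> Q}, forall v, h' (p v) = h v.
  by apply: factor_surj => // v /ip[u <-].
have [g gE] := iQ Q h' Qp.
by exists g; apply: linear_ext => x /=; rewrite gE.
Qed.

(** Dually, a map [J -> I] killed by [f] lands in the image of [i], and it is a coboundary exactly
    when the resulting map [J -> N] lifts through [p]. *)
Lemma sgiP (N : lmodType A) : strongly_gorenstein_injective N <->
  exists (I : lmodType A) (i : {linear N -> I}) (p : {linear I -> N}),
  [/\ injective_module I, short_exact i p &
      forall (J : lmodType A) (h : {linear J -> N}), injective_module J ->
        exists g : {linear J -> I}, forall n, p (g n) = h n].
Proof.
split=> [[I [f [Ii fe fN fJ]]]|[I [i [p [Ii ses pJ]]]]].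
  have [i [p [ses ipE]]] := exact_endo_split fe fN; have [iI pS ip] := ses.
  exists I, i, p; split=> // J h Ji.
  have /exact_atP/(_ (postcomp J i h)) := fJ J Ji.
  case=> [[|g gE]].
    apply: linear_ext => x /=; rewrite -ipE.
    by rewrite (_ : p (i _) = 0) ?linear0//; apply/ip; exists (h x).
  exists g => n; apply: iI; rewrite ipE.
  by have := congr1 (fun k : {linear J -> I} => k n) gE.
have [iI pS ip] := ses; have [fe fN] := short_exact_endo ses.
exists I, (postcomp I i p); split=> // J Ji.
have pi n : p (i n) = 0 by apply/ip; exists n.
apply/exact_atP => h; split=> [h0|[g <-]]; last first.
  by apply: linear_ext => x /=; rewrite pi !linear0.
have hi n : exists u, i u = h n.
  apply/ip/iI; rewrite linear0.
  by have := congr1 (fun k : {linear J -> I} => k n) h0.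
have [h' h'E] := factor_inj iI hi.
have [g gE] := pJ J h' Ji.
by exists g; apply: linear_ext => x /=; rewrite gE h'E.
Qed.

End ShortExact.

(** * Tensor products: right exactness, the Hom adjunction, flatness of projectives *)

Section TensorFunctor.
Variable A : comPzRingType.
Implicit Types M N V : lmodType A.

Lemma tens0l M N (n : N) : tens (0 : M) n = 0.
Proof. by rewrite -(scale0r (0 : M)) tensZl scale0r. Qed.

Lemma tens_sumr M N (I : Type) (r : seq I) (m : M) (f : I -> N) :
  tens m (\sum_(i <- r) f i) = \sum_(i <- r) tens m (f i).
Proof. exact: (linear_sum (mklin ((tens_bilinear M N).1 m))). Qed.

(** Scalars are absorbed by the left factor and zero is a pure tensor, so sums of pure tensors
    exhaust the module. *)
Lemma tensor_ind M N (K : tensor M N -> Prop) :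
  (forall m n, K (tens m n)) -> (forall s t, K s -> K t -> K (s + t)) ->
  forall t, K t.
Proof.
move=> Kt KD t; have [u <-] := quot_proj_surj t.
have <- : free_lift (@free_gen A (M * N)%type) u = u.
  by apply: (@free_ext _ _ _ _ idfun) => x; rewrite free_lift_gen.
rewrite /free_lift /= /free_lift_fun linear_sum.
apply: (big_ind K); [|exact: KD|move=> [m n] _].
  by rewrite -(tens0l M (0 : N)).
by rewrite linearZ_LR -[X in K X]tensZl.
Qed.

(** A form of [tensor_ext] shaped for naturality squares, where each side is a composite of two
    linear maps. *)
Lemma tensor_ext_comp M N V V' (W : lmodType A) (g : {linear tensor M N -> V}) (f : {linear V -> W})
    (g' : {linear tensor M N -> V'}) (f' : {linear V' -> W}) :
  (forall m n, f (g (tens m n)) = f' (g' (tens m n))) ->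
  forall t, f (g t) = f' (g' t).
Proof.
move=> fg t.
exact: (@tensor_ext _ _ _ _ (postcomp _ f g) (postcomp _ f' g') fg).
Qed.

Lemma tensor_mapE M M' (u : {linear M -> M'}) N m (n : N) :
  tensor_map u N (tens m n) = tens (u m) n.
Proof. exact: tensor_liftE. Qed.

Fact tensor_mapr_subproof M N N' (v : {linear N -> N'}) :
  bilinear_map (fun (m : M) (n : N) => tens m (v n)).
Proof.
by split=> [m a n n'|n a m m'] /=; rewrite ?linearP ?tensDl ?tensDr ?tensZl ?tensZr.
Qed.
Definition tensor_mapr M N N' (v : {linear N -> N'}) :
  {linear tensor M N -> tensor M N'} := tensor_lift (tensor_mapr_subproof M v).

Lemma tensor_maprE M N N' (v : {linear N -> N'}) (m : M) n :
  tensor_mapr M v (tens m n) = tens m (v n).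
Proof. exact: tensor_liftE. Qed.

Lemma tensor_mapC M M' N N' (u : {linear M -> M'}) (v : {linear N -> N'}) t :
  tensor_map u N' (tensor_mapr M v t) = tensor_mapr M' v (tensor_map u N t).
Proof.
move: t; apply: tensor_ext_comp => m n.
by rewrite tensor_maprE !tensor_mapE tensor_maprE.
Qed.

(** Additivity of the functor [M (x) -], applied to a decomposition of the identity of [L]. *)
Lemma tensor_mapr_sum M (L1 L2 L : lmodType A) (s1 : {linear L1 -> L})
    (s2 : {linear L2 -> L}) (r1 : {linear L -> L1}) (r2 : {linear L -> L2}) :
  (forall x, s1 (r1 x) + s2 (r2 x) = x) ->
  forall t, tensor_mapr M s1 (tensor_mapr M r1 t) +
            tensor_mapr M s2 (tensor_mapr M r2 t) = t.
Proof.
move=> sr; pose f := precomp _ (tensor_mapr M r1) (tensor_mapr M s1)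
                   + precomp _ (tensor_mapr M r2) (tensor_mapr M s2).
apply: (@tensor_ext _ _ _ _ f idfun) => m x.
change (tensor_mapr M s1 (tensor_mapr M r1 (tens m x)) +
        tensor_mapr M s2 (tensor_mapr M r2 (tens m x)) = tens m x).
by rewrite 4!tensor_maprE -tensDr sr.
Qed.

Fact tensor_swap_subproof M N : bilinear_map (fun (m : M) (n : N) => tens n m).
Proof.
by split=> [m a n n'|n a m m'] /=; rewrite ?tensDl ?tensDr ?tensZl ?tensZr.
Qed.
Definition tensor_swap M N : {linear tensor M N -> tensor N M} :=
  tensor_lift (tensor_swap_subproof M N).

Lemma tensor_swapE M N (m : M) (n : N) : tensor_swap M N (tens m n) = tens n m.
Proof. exact: tensor_liftE. Qed.

Lemma tensor_swapK M N : cancel (tensor_swap M N) (tensor_swap N M).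
Proof.
apply: (@tensor_ext _ _ _ _ (postcomp _ (tensor_swap N M) (tensor_swap M N)) idfun).
by move=> m n; rewrite postcompE 2!tensor_swapE.
Qed.

(** Naturality of the symmetry, which carries results about maps in the left factor over to the
    right factor. *)
Lemma tensor_swap_mapr M N N' (v : {linear N -> N'}) t :
  tensor_swap M N' (tensor_mapr M v t) = tensor_map v M (tensor_swap M N t).
Proof.
move: t; apply: tensor_ext_comp => m n.
by rewrite tensor_maprE !tensor_swapE tensor_mapE.
Qed.

Section RightExact.
Variables (U V W : lmodType A) (i : {linear U -> V}) (p : {linear V -> W}).
Hypotheses (pS : surj_map p) (ip : forall v, p v = 0 <-> exists u, i u = v).
Variable N : lmodType A.

Lemma tensor_map_surj : surj_map (tensor_map p N).
Proof.
move=> t; elim/tensor_ind: t => [m n|s t [x <-] [y <-]].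
  by have [v <-] := pS m; exists (tens v n); rewrite tensor_mapE.
by exists (x + y); exact: linearD.
Qed.

(* [p (x) N] is injective modulo the image of [i (x) N], since [w (x) n] lifts
   unambiguously to the quotient. *)
Lemma tensor_map_exact t :
  tensor_map p N t = 0 <-> exists s, tensor_map i N s = t.
Proof.
split=> [|[s <-]]; last first.
  move: s; apply: (@tensor_ext _ _ _ _
    (postcomp _ (tensor_map p N) (tensor_map i N)) \0) => u n.
  rewrite postcompE !tensor_mapE (_ : p (i u) = 0); last by apply/ip; exists u.
  exact: tens0l.
pose Q := im (tensor_map i N).
have /choice[s sP] := pS.
pose b (w : W) (n : N) : quotmod Q := quot_proj Q (tens (s w) n).
have bE v n : b (p v) n = quot_proj Q (tens v n).
  apply/quot_projP/asboolP.
  have /ip[u uE] : p (s (p v) - v) = 0 by rewrite linearB sP subrr.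
  exists (tens u n); rewrite tensor_mapE uE tensDl -scaleN1r tensZl.
  by rewrite scaleN1r.
have bB : bilinear_map b.
  split=> [w a n n'|n a w w'] /=; first by rewrite /b tensDr tensZr linearP.
  have [[v <-] [v' <-]] := (pS w, pS w').
  by rewrite -linearP !bE tensDl tensZl linearP.
have E : tensor_lift bB (tensor_map p N t) = quot_proj Q t.
  move: t; apply: (@tensor_ext _ _ _ _
    (postcomp _ (tensor_lift bB) (tensor_map p N)) (quot_proj Q)) => v n.
  by rewrite postcompE tensor_mapE tensor_liftE bE.
move=> t0; move: E; rewrite t0 linear0 => /esym/quot_proj_eq0.
by move/asboolP.
Qed.

End RightExact.

Lemma tensor_mapr_surj (V W : lmodType A) (p : {linear V -> W}) M :
  surj_map p -> surj_map (tensor_mapr M p).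
Proof.
move=> pS t; have [x xE] := tensor_map_surj pS (tensor_swap _ _ t).
exists (tensor_swap _ _ x); apply: (can_inj (@tensor_swapK _ _)).
by rewrite tensor_swap_mapr tensor_swapK xE.
Qed.

Lemma tensor_mapr_exact (U V W : lmodType A) (i : {linear U -> V})
    (p : {linear V -> W}) M t :
  surj_map p -> (forall v, p v = 0 <-> exists u, i u = v) ->
  tensor_mapr M p t = 0 <-> exists s, tensor_mapr M i s = t.
Proof.
move=> pS ip; have E := tensor_map_exact pS ip (tensor_swap _ _ t).
rewrite -tensor_swap_mapr in E.
split=> [t0|[s st]].
  have [|s st] := E.1; first by rewrite t0 linear0.
  exists (tensor_swap _ _ s); apply: (can_inj (@tensor_swapK _ _)).
  by rewrite tensor_swap_mapr tensor_swapK.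
apply: (can_inj (@tensor_swapK _ _)); rewrite linear0; apply/E.
by exists (tensor_swap _ _ s); rewrite -tensor_swap_mapr st.
Qed.

Lemma tensor_mapr_inj (F M N : lmodType A) (v : {linear M -> N}) :
  flat F -> injective v -> injective (tensor_mapr F v).
Proof.
move=> Ff vI x y /(congr1 (tensor_swap F N)); rewrite 2!tensor_swap_mapr.
by move=> /(Ff _ _ _ vI)/(can_inj (@tensor_swapK _ _)).
Qed.

Fact uncurry_subproof (M N V : lmodType A) (f : {linear M -> {linear N -> V}}) :
  bilinear_map (fun m n => f m n).
Proof. by split=> [m a n n'|n a m m'] /=; rewrite linearP. Qed.

Lemma tensor_curry (M N V : lmodType A) (f : {linear tensor M N -> V}) :
  exists g : {linear M -> {linear N -> V}}, forall m n, g m n = f (tens m n).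
Proof.
have fL m : linear (fun n => f (tens m n)).
  by move=> a n n' /=; rewrite -linearP tensDr tensZr.
have gL : linear (fun m => mklin (fL m)).
  by move=> a m m'; apply: linear_ext => n /=; rewrite -linearP tensDl tensZl.
by exists (mklin gL).
Qed.

(** By adjunction, maps out of [P (x) Q] are maps from [P] to [Hom(Q, -)], and both [Hom(Q, -)] and
    [Hom(P, -)] preserve surjections. *)
Lemma projective_tensor (P Q : lmodType A) :
  projective P -> projective Q -> projective (tensor P Q).
Proof.
move=> Pp Qp X Y p f pS; have [f' f'E] := tensor_curry f.
have pS' : surj_map (postcomp Q p).
  move=> h; have [g gE] := Qp _ _ p h pS.
  by exists g; apply: linear_ext.
have [g gE] := Pp _ _ _ f' pS'.
exists (tensor_lift (uncurry_subproof g)).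
apply: (@tensor_ext _ _ _ _ (postcomp _ p (tensor_lift _)) f) => m n.
rewrite postcompE tensor_liftE -f'E.
by have := congr1 (fun k : {linear Q -> Y} => k n) (gE m).
Qed.

(** By adjunction, maps into [Hom(F, I)] are maps from [- (x) F] to [I], and [- (x) F] preserves
    injections. *)
Lemma injective_hom_flat (F I : lmodType A) :
  flat F -> injective_module I -> injective_module {linear F -> I}.
Proof.
move=> Ff Ii X Y u f uI.
have [g gE] := Ii _ _ _ (tensor_lift (uncurry_subproof f)) (Ff _ _ _ uI).
have [g' g'E] := tensor_curry g.
exists g' => x; apply: linear_ext => n /=; rewrite g'E.
have : g (tensor_map u F (tens x n)) = tensor_lift (uncurry_subproof f) (tens x n) :=
  gE _.
by rewrite tensor_mapE tensor_liftE.
Qed.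

(** [X (x) F] is a retract of [X (x) G], naturally in [X]. *)
Lemma flat_retract (F G : lmodType A) (s : {linear F -> G}) (r : {linear G -> F}) :
  (forall x, r (s x) = x) -> flat G -> flat F.
Proof.
move=> rs Gf X Y u uI x y /(congr1 (tensor_mapr Y s)).
rewrite -2!tensor_mapC => /(Gf _ _ _ uI)/(congr1 (tensor_mapr X r)).
have K : cancel (tensor_mapr X s) (tensor_mapr X r).
  apply: (@tensor_ext _ _ _ _
    (postcomp _ (tensor_mapr X r) (tensor_mapr X s)) idfun) => m n.
  by rewrite postcompE !tensor_maprE rs.
by rewrite 2!K.
Qed.

Section FlatFree.
Variables (S : choiceType) (M : lmodType A).

Fact tensor_coef_subproof (s : S) :
  bilinear_map (fun (m : M) (u : freemod A S) => free_coef u s *: m).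
Proof.
split=> [m a u v|u a m m'] /=; first by rewrite free_coef_linear scalerDl scalerA.
by rewrite scalerDr !scalerA mulrC.
Qed.
(** The coordinate at [s] when [M (x) A^(S)] is viewed as a direct sum of copies of [M]. *)
Definition tensor_coef (s : S) : {linear tensor M (freemod A S) -> M} :=
  tensor_lift (tensor_coef_subproof s).

Lemma tensor_coefE s m u : tensor_coef s (tens m u) = free_coef u s *: m.
Proof. exact: tensor_liftE. Qed.

Lemma tensor_coef_eq0 t : (forall s, tensor_coef s t = 0) -> t = 0.
Proof.
(* Quantifying over all finite supersets of [D] lets the expansions of two tensors be added over a
   common index set. *)
pose K (t : tensor M (freemod A S)) := exists2 D : set S, finite_set D &
  forall D', finite_set D' -> (D `<=` D')%classic ->
  t = \sum_(s <- fset_set D') tens (tensor_coef s t) (free_gen A s).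
have: K t.
  elim/tensor_ind: t => [m u|t t' [D Df DE] [D' D'f D'E]].
    exists (free_supp u); first exact: free_supp_finite.
    move=> D Df uD.
    have uE : u = \sum_(s <- fset_set D) free_coef u s *: free_gen A s.
      rewrite -(free_lift_funE _ Df uD).
      by apply: (@free_ext _ _ _ idfun (free_lift _)) => s; rewrite free_lift_gen.
    rewrite {1}uE tens_sumr; apply: eq_bigr => s _.
    by rewrite tensor_coefE tensZl tensZr.
  exists (D `|` D')%classic; first by rewrite finite_setU.
  move=> B Bf BD.
  have tE := DE B Bf (subset_trans (@subsetUl _ D D') BD).
  have t'E := D'E B Bf (subset_trans (@subsetUr _ D D') BD).
  apply: (etrans (congr2 +%R tE t'E)); rewrite -big_split; apply: eq_bigr => s _.
  by rewrite (linearD (tensor_coef s)) tensDl.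
move=> [D Df DE] t0; rewrite (DE D)// big1// => s _.
by rewrite t0 tens0l.
Qed.

End FlatFree.

(** Injectivity is tested coordinatewise, and on each coordinate the map induced by [u] is [u]
    itself. *)
Lemma flat_freemod (S : choiceType) : flat (freemod A S).
Proof.
move=> X Y u uI; apply: linear_inj => t ut.
apply: tensor_coef_eq0 => s; apply: uI; rewrite linear0.
have <- : tensor_coef Y s (tensor_map u _ t) = u (tensor_coef X s t).
  move: {ut}t; apply: tensor_ext_comp => m n.
  by rewrite tensor_mapE !tensor_coefE linearZ.
by rewrite ut linear0.
Qed.

Lemma flat_projective (P : lmodType A) : projective P -> flat P.
Proof.
move=> Pp; have [s sE] := Pp _ _ (free_cover P) idfun (@free_cover_surj _ P).
exact: (flat_retract (r := free_cover P) sE (@flat_freemod P)).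
Qed.

End TensorFunctor.

(** * Base change along a ring morphism, as left adjoint to restriction *)

Section ChangeOfRings.
Variables (A R : comPzRingType) (phi : {rmorphism A -> R}).
Local Notation RA := (restrict phi R^o).

(** Two [A]-actions live on the same additive group, one restricted from [R] and one from the tensor
    product; they agree because scalars cross the tensor sign. *)
Lemma base_change_restrict_scale (M : lmodType A) a (t : tensor M RA) :
  phi a *: (t : base_change phi M) = (a *: t : tensor M RA).
Proof.
apply: (@tensor_ext _ _ _ _ (base_change_act phi M (phi a)) (a \*: idfun)) => m s.
by rewrite base_change_actE -[RHS]tensZr.
Qed.

Definition tens1 (M : lmodType A) (m : M) : base_change phi M :=
  @tens A M RA m (1 : R).

Lemma tens1E (M : lmodType A) (m : M) (s : RA) :
  tens m s = (s : R) *: (tens1 m).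
Proof. by rewrite /tens1 base_change_scaleE mulr1. Qed.

Fact base_change_unit_linear (M : lmodType A) :
  linear (fun m : M => tens1 m : restrict phi (base_change phi M)).
Proof.
by move=> a m m'; rewrite /tens1 tensDl tensZl -base_change_restrict_scale.
Qed.
Definition base_change_unit (M : lmodType A) :
  {linear M -> restrict phi (base_change phi M)} :=
  mklin (@base_change_unit_linear M).

Lemma base_change_ext (M : lmodType A) (V : lmodType R)
    (f g : {linear base_change phi M -> V}) :
  (forall m, f (tens1 m) = g (tens1 m)) -> f =1 g.
Proof.
move=> fg; apply: tensor_ind => [m s|s t Hs Ht].
  by rewrite tens1E !linearZ_LR fg.
by rewrite (linearD f s t) (linearD g s t) Hs Ht.
Qed.

Lemma base_change_lift (M : lmodType A) (V : lmodType R)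
    (h : {linear M -> restrict phi V}) :
  exists g : {linear base_change phi M -> V},
    forall m s, g (tens m (s : RA)) = (s : R) *: (h m : V).
Proof.
pose b (m : M) (s : RA) : restrict phi V := (s : R) *: (h m : V).
have bB : bilinear_map b.
  split=> [m a s s'|s a m m'] /=; rewrite /b.
    by rewrite scalerDl restrict_scaleE /= -scalerA.
  by rewrite linearP scalerDr !restrict_scaleE !scalerA mulrC.
have scL (r : R) : linear (fun v : restrict phi V => r *: (v : V) : restrict phi V).
  by move=> a v v'; rewrite scalerDr !restrict_scaleE !scalerA mulrC.
(* [tensor_lift] provides [A]-linearity; compatibility with [R] is checked on pure tensors. *)
have gZ r t : tensor_lift bB (base_change_act phi M r t) =
              r *: (tensor_lift bB t : V).
  apply: (@tensor_ext_comp _ _ _ _ _ _ (base_change_act phi M r) (tensor_lift bB)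
    (tensor_lift bB) (mklin (scL r))) t => m s.
  rewrite base_change_actE 2!(tensor_liftE bB) /b.
  by rewrite -scalerA.
have gL : linear (tensor_lift bB : base_change phi M -> V).
  by move=> r s t; rewrite -gZ -linearD.
by exists (mklin gL) => m s; exact: (tensor_liftE bB).
Qed.

Fact base_change_map_linear (M N : lmodType A) (u : {linear M -> N}) :
  linear (tensor_map u RA : base_change phi M -> base_change phi N).
Proof.
move=> r s t.
have E : tensor_map u RA (base_change_act phi M r s) =
         base_change_act phi N r (tensor_map u RA s).
  move: s; apply: tensor_ext_comp => m s.
  by rewrite base_change_actE 2!tensor_mapE base_change_actE.
exact: (etrans (linearD (tensor_map u RA) _ _) (congr1 (+%R^~ _) E)).
Qed.
Definition base_change_map (M N : lmodType A) (u : {linear M -> N}) :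
    {linear base_change phi M -> base_change phi N} :=
  mklin (base_change_map_linear u).

Lemma base_change_mapE (M N : lmodType A) (u : {linear M -> N}) m (s : RA) :
  base_change_map u (tens m s) = tens (u m) s.
Proof. exact: tensor_mapE. Qed.

Lemma projective_base_change (P : lmodType A) :
  projective P -> projective (base_change phi P).
Proof.
move=> Pp X Y p f pS.
have [g gE] := Pp _ _ (restrict_lin phi p)
  (postcomp _ (restrict_lin phi f) (base_change_unit P)) pS.
have [g' g'E] := base_change_lift g.
exists g'; apply: (@base_change_ext _ _ (postcomp _ p g') f) => m.
rewrite postcompE /tens1 g'E scale1r; exact: gE.
Qed.

(** The transpose of a free [A]-cover of [Q] is onto, so it splits over [R]; the splitting is
    recorded over [A], where the extension problems will be posed. *)
Lemma projective_base_change_cover (Q : lmodType R) : projective Q ->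
  exists (F : lmodType A) (s : {linear restrict phi Q -> tensor F RA})
      (r : {linear tensor F RA -> restrict phi Q}),
    projective F /\ forall q, r (s q) = q.
Proof.
move=> Qp; pose F : lmodType A := freemod A (restrict phi Q).
have [r rE] := base_change_lift (free_cover (restrict phi Q)).
have rS : surj_map r.
  move=> q; have [u uE] := free_cover_surj (q : restrict phi Q).
  by exists (tens1 u); rewrite /tens1 rE scale1r uE.
have [s sE] := Qp _ _ r idfun rS.
have sL : linear (s : restrict phi Q -> tensor F RA).
  by move=> a x y; rewrite linearP base_change_restrict_scale.
have rL : linear (r : tensor F RA -> restrict phi Q).
  by move=> a x y; rewrite -base_change_restrict_scale; exact: linearP.
exists F, (mklin sL), (mklin rL); split=> [|q]; [exact: freemod_projective|exact: sE].
Qed.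

End ChangeOfRings.

(** * Vanishing of Ext and Tor for a module that is its own syzygy *)

Section PeriodicModule.
Variables (A : comPzRingType) (M P : lmodType A).
Variables (i : {linear M -> P}) (p : {linear P -> M}).
Hypotheses (Pp : projective P) (ses : short_exact i p).

(** For a short exact sequence [M -> P -> M] with [P] projective, this is the vanishing of
    [Ext^1(M, L)]. *)
Definition extends_along (L : lmodType A) : Prop :=
  forall h : {linear M -> L}, exists g : {linear P -> L}, forall m, g (i m) = h m.

(* As [M] is its own syzygy, the obstruction [Ext^1(M, X)] equals
   [Ext^2(M, U) = Ext^1(M, U)]. *)
Lemma extends_along_coker (U F X : lmodType A) (j : {linear U -> F})
    (q : {linear F -> X}) :
  short_exact j q -> extends_along U -> extends_along F -> extends_along X.
Proof.
move=> [jI qS jq] UE FE h; have [iI pS ip] := ses.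
(* [k] lifts [h \o p] along [q], and its restriction to [M] falls into [U] as [k']. *)
have [k kE] : exists k : {linear P -> F}, forall x, q (k x) = h (p x).
  by have [k kE] := Pp (precomp _ p h) qS; exists k.
have [k' k'E] : exists k' : {linear M -> U}, forall m, j (k' m) = k (i m).
  apply: (factor_inj (h := precomp _ i k) jI) => m; apply/jq; rewrite /= kE.
  by rewrite (_ : p (i m) = 0) ?linear0//; apply/ip; exists m.
have [g gE] := UE k'.
(* Subtracting an extension of [k'] makes [k] vanish on [M], hence descend along [p]; the correction
   is invisible after [q]. *)
have [l lE] : exists l : {linear M -> F}, forall x, l (p x) = k x - j (g x).
  apply: (factor_surj (h := k - precomp _ g j) pS) => _ /ip[m <-] /=.
  by rewrite gE k'E subrr.
have [l' l'E] := FE l.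
exists (precomp _ l' q) => m /=; rewrite l'E.
have [x <-] := pS m.
rewrite lE linearB kE (_ : q (j _) = 0) ?subr0//.
by apply/jq; exists (g x).
Qed.

Lemma extends_along_sum (L1 L2 L : lmodType A) (s1 : {linear L1 -> L})
    (s2 : {linear L2 -> L}) (r1 : {linear L -> L1}) (r2 : {linear L -> L2}) :
  (forall x, s1 (r1 x) + s2 (r2 x) = x) ->
  extends_along L1 -> extends_along L2 -> extends_along L.
Proof.
move=> sr E1 E2 h.
have [g1 g1E] := E1 (precomp _ h r1).
have [g2 g2E] := E2 (precomp _ h r2).
exists (precomp _ g1 s1 + precomp _ g2 s2) => m.
by rewrite lin_addE /= g1E g2E /= sr.
Qed.

Lemma extends_along_retract (L L' : lmodType A) (s : {linear L -> L'})
    (r : {linear L' -> L}) :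
  (forall x, r (s x) = x) -> extends_along L' -> extends_along L.
Proof.
move=> rs E h; have [g gE] := E (precomp _ h s).
by exists (precomp _ g r) => m /=; rewrite gE /= rs.
Qed.

(** Tensoring with [F] keeps a projective resolution of [X] exact, by flatness, and its terms
    projective, so dimension shifting applies to [F (x) X]. *)
Lemma extends_along_tensor (F X : lmodType A) :
  (forall Q : lmodType A, projective Q -> extends_along Q) ->
  projective F -> finite_pd X -> extends_along (tensor F X).
Proof.
move=> QE Fp [n [C [Cp Cn]]].
apply: (resolution_ind (cl := @projective A) (K := fun X => extends_along (tensor F X)))
  Cp Cn => [Z Z0 h|U G Y j q [jI qS jq] Gp UE].
  exists \0 => m /=; apply/esym.
  have z0 : forall t : tensor F Z, t = 0.
    apply: tensor_ind => [x z|s t -> ->]; last by rewrite addr0.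
    by rewrite (Z0 z) -(scale0r (0 : Z)) tensZr scale0r.
  exact: z0.
apply: (@extends_along_coker _ _ _ (tensor_mapr F j) (tensor_mapr F q)) UE _.
  split; [exact: (tensor_mapr_inj (flat_projective Fp))|exact: tensor_mapr_surj|].
  by move=> v; exact: tensor_mapr_exact.
exact/QE/projective_tensor.
Qed.

(* [Tor_1(M, X) = Tor_2(M, X) = Tor_1(M, U)], chased through elements. *)
Lemma tensor_map_inj_coker (U F X : lmodType A) (j : {linear U -> F})
    (q : {linear F -> X}) :
  short_exact j q -> flat F ->
  injective (tensor_map i U) -> injective (tensor_map i X).
Proof.
move=> [jI qS jq] Ff UI; have [iI pS ip] := ses; apply: linear_inj => t it0.
have [c ct] := tensor_mapr_surj (M := M) qS t.
have [b bE] : exists b, tensor_mapr P j b = tensor_map i F c.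
  apply/(tensor_mapr_exact _ qS jq).
  by rewrite -(tensor_mapC i q) ct.
have [b' b'E] : exists b', tensor_map i U b' = b.
  apply/(tensor_map_exact pS ip).
  (* That [p (x) U] kills [b] may be tested in [P (x) F], by injectivity of [i (x) U] and flatness
     of [P]; there it reduces to [p \o i = 0]. *)
  apply: UI; rewrite linear0.
  apply: (tensor_mapr_inj (flat_projective Pp) jI); rewrite linear0.
  rewrite -(tensor_mapC i j) -(tensor_mapC p j) bE.
  have -> : tensor_map p F (tensor_map i F c) = 0.
    by apply/(tensor_map_exact pS ip); exists c.
  exact: linear0.
rewrite -ct; apply/(tensor_mapr_exact _ qS jq); exists b'.
apply: (Ff _ _ _ iI).
by rewrite (tensor_mapC i j) b'E.
Qed.

Lemma tensor_map_inj_finite_fd (X : lmodType A) :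
  finite_fd X -> injective (tensor_map i X).
Proof.
move=> [n [C [Cf Cn]]].
apply: (resolution_ind (cl := @flat A) (K := fun X => injective (tensor_map i X)))
  Cf Cn => [Z Z0|U G Y j q ]; last first.
  by move=> js Gf UI; exact: (tensor_map_inj_coker js).
apply: linear_inj => t _; move: t; apply: tensor_ind => [x z|s t -> ->].
  by rewrite (Z0 z) -(scale0r (0 : Z)) tensZr scale0r.
by rewrite addr0.
Qed.

Lemma tensor_map_inj_sum (L1 L2 L : lmodType A) (s1 : {linear L1 -> L})
    (s2 : {linear L2 -> L}) (r1 : {linear L -> L1}) (r2 : {linear L -> L2}) :
  (forall x, s1 (r1 x) + s2 (r2 x) = x) ->
  injective (tensor_map i L1) -> injective (tensor_map i L2) ->
  injective (tensor_map i L).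
Proof.
move=> sr I1 I2; apply: linear_inj => t it0.
have r1t : tensor_mapr M r1 t = 0.
  by apply: I1; rewrite (tensor_mapC i r1) it0 !linear0.
have r2t : tensor_mapr M r2 t = 0.
  by apply: I2; rewrite (tensor_mapC i r2) it0 !linear0.
by rewrite -(tensor_mapr_sum sr t) r1t r2t 2!linear0 addr0.
Qed.

End PeriodicModule.

Lemma projective_regular (A : comPzRingType) : projective (A^o : lmodType A).
Proof.
move=> X Y p f pS; have [x xE] := pS (f 1).
have gL : linear (fun a : A^o => (a : A) *: x).
  by move=> a b c; rewrite scalerDl -scalerA.
exists (mklin gL) => a /=.
by rewrite linearZ xE -linearZ; congr (f _); exact: mulr1.
Qed.

Lemma finite_fd_of_pd (A : comPzRingType) (X : lmodType A) :
  finite_pd X -> finite_fd X.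
Proof.
move=> [n [C [Cp Cn]]]; exists n, C; split=> // i.
exact: flat_projective.
Qed.

(** * Ascent of strong Gorenstein projectivity to the trivial extension *)

Section TrivialExtension.
Variables (A : comPzRingType) (E : lmodType A).
Local Notation R := (triv_ext E).
Local Notation phi := (@triv_incl A E).
Local Notation RA := (restrict phi R^o).

Fact triv_injl_linear : linear (fun a : A^o => ((a, 0) : R) : RA).
Proof.
by move=> a b c; rewrite restrict_scaleE; congr pair; rewrite /= ?scaler0 !addr0.
Qed.
Fact triv_injr_linear : linear (fun e : E => ((0, e) : R) : RA).
Proof.
move=> a b c; rewrite restrict_scaleE; congr pair; rewrite /= ?scaler0 ?addr0//.
by rewrite mulr0.
Qed.
Fact triv_projl_linear : linear (fun r : RA => (r : R).1 : A^o).
Proof. by []. Qed.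
Fact triv_projr_linear : linear (fun r : RA => (r : R).2 : E).
Proof. by move=> a b c /=; rewrite scaler0 addr0. Qed.

(** As an [A]-module, [R] is the direct sum of [A] and [E]; questions about [R] thus split into one
    about [A] and one about [E]. *)
Lemma triv_ext_split (x : RA) :
  mklin triv_injl_linear (mklin triv_projl_linear x) +
  mklin triv_injr_linear (mklin triv_projr_linear x) = x.
Proof. by case: x => a e; congr pair; rewrite /= ?addr0 ?add0r. Qed.

Lemma sgp_base_change_triv_ext (M : lmodType A) :
  finite_pd E -> strongly_gorenstein_projective M ->
  strongly_gorenstein_projective (base_change phi M).
Proof.
move=> Epd /sgpP[P [i [p [Pp ses iQ]]]]; have [iI pS ip] := ses.
apply/sgpP; exists (base_change phi P), (base_change_map phi i), (base_change_map phi p).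
split; first exact: projective_base_change.
  split=> [||v]; [|exact: tensor_map_surj|exact: tensor_map_exact].
  apply: (tensor_map_inj_sum triv_ext_split).
    exact: (flat_projective (@projective_regular A)).
  exact: (tensor_map_inj_finite_fd Pp ses (finite_fd_of_pd Epd)).
(* By adjunction it is enough to extend the [A]-linear map sending [m] to [h (m (x) 1)], and over
   [A] the module [Q] is a retract of [F (x) R]. *)
move=> Q h /(projective_base_change_cover phi)[F [s [r [Fp rs]]]].
have QE Q' : projective Q' -> extends_along i Q' by move=> Qp h'; exact: iQ.
have FE : extends_along i (tensor F RA).
  apply: (extends_along_sum (tensor_mapr_sum (M := F) triv_ext_split)).
  - exact/QE/projective_tensor/projective_regular.
  - exact: (extends_along_tensor Pp ses).
have QQ := extends_along_retract rs FE.
have [g gE] := QQ (postcomp _ (restrict_lin phi h) (base_change_unit phi M)).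
have [g' g'E] := base_change_lift g.
exists g'; apply: (@base_change_ext _ _ _ _ _ (postcomp _ g' (base_change_map phi i)) h).
move=> m; rewrite postcompE base_change_mapE g'E scale1r gE.
by [].
Qed.

End TrivialExtension.

(** * Descent from the trivial extension by reduction modulo [E] *)

Section Descent.
Variables (A : comPzRingType) (E : lmodType A).
Local Notation R := (triv_ext E).
Local Notation phi := (@triv_incl A E).
Local Notation RA := (restrict phi R^o).

(** The augmentation of [R], through which an [A]-module becomes an [R]-module annihilated by the
    ideal [0 x E]. *)
Definition triv_proj (r : R) : A := r.1.
Fact triv_proj_zmod : zmod_morphism triv_proj.
Proof. by []. Qed.
Fact triv_proj_monoid : monoid_morphism triv_proj.
Proof. by []. Qed.
HB.instance Definition _ :=
  GRing.isZmodMorphism.Build R A triv_proj triv_proj_zmod.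
HB.instance Definition _ :=
  GRing.isMonoidMorphism.Build R A triv_proj triv_proj_monoid.

Local Notation ER := (restrict triv_proj E).

Definition triv_injr (e : E) : R := (0, e).

Lemma triv_injrM (r : R) e : r * triv_injr e = triv_injr (r.1 *: e).
Proof. by congr pair; rewrite /= ?mulr0// scale0r addr0. Qed.

Section Multiplication.
Variable N : lmodType R.

Fact triv_mul_subproof : bilinear_map (fun (x : N) (e : ER) => triv_injr e *: x).
Proof.
split=> [x r e e'|e r x x'] /=; last by rewrite scalerDr !scalerA mulrC.
rewrite scalerA triv_injrM -scalerDl; congr (_ *: _).
by congr pair; rewrite /= addr0.
Qed.
(** With [E] identified with the ideal [0 x E], this is multiplication [N (x)_R E -> N], whose image
    is [EN]. *)
Definition triv_mul_map : {linear tensor N ER -> N} := tensor_lift triv_mul_subproof.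

Lemma triv_mul_mapE (x : N) (e : ER) : triv_mul_map (tens x e) = triv_injr e *: x.
Proof. exact: tensor_liftE. Qed.

End Multiplication.

Lemma triv_mul_map_nat (N N' : lmodType R) (f : {linear N -> N'}) t :
  f (triv_mul_map N t) = triv_mul_map N' (tensor_map f ER t).
Proof.
move: t; apply: tensor_ext_comp => x e.
by rewrite triv_mul_mapE tensor_mapE triv_mul_mapE linearZ_LR.
Qed.

Lemma triv_mul_map_kill (N : lmodType R) (Y : lmodType A)
    (f : {linear N -> restrict triv_proj Y}) t : f (triv_mul_map N t) = 0.
Proof.
move: t; apply: (@tensor_ext _ _ _ _ (postcomp _ f (triv_mul_map N)) \0) => x e.
rewrite postcompE triv_mul_mapE linearZ_LR restrict_scaleE.
exact: scale0r.
Qed.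

Section Cokernel.
Variable N : lmodType R.

(** The module [N/EN], that is, [N (x)_R A]. *)
Definition triv_coker : lmodType A :=
  quotmod (im (restrict_lin phi (triv_mul_map N))).

Definition triv_coker_proj : {linear restrict phi N -> triv_coker} := quot_proj _.

Lemma triv_coker_proj_eq0 x :
  triv_coker_proj x = 0 <-> exists t, triv_mul_map N t = x.
Proof. by rewrite quot_proj_eq0; split=> /asboolP. Qed.

(** The difference between [r] and [phi r.1] lies in the ideal [0 x E]. *)
Lemma triv_coker_projZ (r : R) x :
  triv_coker_proj (r *: (x : N)) = r.1 *: triv_coker_proj x.
Proof.
apply/eqP; rewrite -linearZ_LR -subr_eq0 -linearB; apply/eqP/triv_coker_proj_eq0.
exists (tens (x : N) (r.2 : ER)); rewrite triv_mul_mapE.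
have -> : triv_injr r.2 = r - phi r.1.
  by case: r => a e; congr pair; rewrite /= ?subrr ?subr0.
exact: scalerBl.
Qed.

(** Reduction modulo [E] is left adjoint to restriction along the augmentation, since [f] kills
    [EN]. *)
Lemma triv_coker_lift (Y : lmodType A) (f : {linear N -> restrict triv_proj Y}) :
  exists g : {linear triv_coker -> Y}, forall x, g (triv_coker_proj x) = f x.
Proof.
have fL : linear (f : restrict phi N -> Y).
  by move=> a x y; rewrite restrict_scaleE linearP.
have fK x : x \in im (restrict_lin phi (triv_mul_map N)) -> mklin fL x = 0.
  by move=> /asboolP[t <-]; exact: triv_mul_map_kill.
by exists (quot_lift fK) => x; exact: quot_liftE.
Qed.

Lemma projective_triv_coker : projective N -> projective triv_coker.
Proof.
move=> Np X Y p f pS.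
have fL : linear (fun x : N => f (triv_coker_proj x) : restrict triv_proj Y).
  move=> r x y.
  by rewrite (linearD triv_coker_proj (r *: x) y) triv_coker_projZ linearP.
have [g gE] := Np _ _ (restrict_lin triv_proj p) (mklin fL) pS.
have [g' g'E] := triv_coker_lift g.
exists g' => q; have [x <-] := quot_proj_surj q.
by rewrite /= g'E; exact: gE.
Qed.

End Cokernel.

Section BaseChange.
Variable M : lmodType A.
Local Notation N := (base_change phi M).

(** Reads off the [E]-component of [m (x) s]; the induced [A]-linear map will be a left inverse of
    multiplication. *)
Fact triv_section_subproof : bilinear_map
  (fun (m : M) (s : RA) =>
     tens (tens1 phi m) ((s : R).2 : ER) : restrict phi (tensor N ER)).
Proof.
split=> [m a s s'|s a m m'] /=.
  rewrite restrict_scaleE /= scaler0 addr0 tensDr; congr (_ + _).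
  exact: (tensZr (phi a)).
rewrite restrict_scaleE -tensZl -tensDl; congr tens.
exact: (linearP (base_change_unit phi M)).
Qed.

(* For [N = M (x)_A R], [N (x)_R E] is [M (x)_A E], a direct summand of [N]. *)
Lemma triv_mul_map_inj : injective (triv_mul_map N).
Proof.
pose l := tensor_lift triv_section_subproof.
have lE t : l (triv_mul_map N t) = t.
  elim/tensor_ind: t => [n e|s t Hs Ht]; last first.
    apply: etrans (congr1 l (linearD (triv_mul_map N) s t)) _.
    exact: etrans (linearD l _ _) (congr2 +%R Hs Ht).
  rewrite triv_mul_mapE; elim/tensor_ind: n => [m r|n n' Hn Hn']; last first.
    apply: etrans (congr1 l (scalerDr (triv_injr e) (n : N) n')) _.
    apply: etrans (linearD l _ _) (etrans (congr2 +%R Hn Hn') _).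
    exact/esym/tensDl.
  (* Moving [r] across the tensor over [R] turns [(m (x) r) (x) e] into [(m (x) 1) (x) r.1 e], which
     is what [l] returns. *)
  rewrite base_change_scaleE tensor_liftE tens1E tensZl -tensZr restrict_scaleE.
  by rewrite [_ * _]mulrC triv_injrM.
exact: (can_inj lE).
Qed.

(** The map [nu] sends [m (x) (a, e)] to [am]; it identifies [N/EN] with [M]. *)
Lemma base_change_collapse : exists nu : {linear N -> restrict triv_proj M},
  (forall m, nu (tens1 phi m) = m) /\
  forall n, nu n = 0 <-> exists t, triv_mul_map N t = n.
Proof.
have hL : linear (id : M -> restrict phi (restrict triv_proj M)) by [].
have [nu nuE] := base_change_lift (mklin hL).
have nu1 m : nu (tens1 phi m) = m by rewrite /tens1 nuE scale1r.
exists nu; split=> // n; split=> [nu0|[t <-]]; last exact: triv_mul_map_kill.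
(* Every [n] differs from [nu n (x) 1] by an element of [EN]. *)
have : exists t, triv_mul_map N t = n - tens1 phi (nu n : M).
  elim/tensor_ind: {nu0}n => [m [a e]|n n' [t tE] [t' t'E]].
    exists (tens (tens1 phi m) (e : ER)); rewrite triv_mul_mapE.
    have -> : nu (tens m ((a, e) : RA)) = a *: m by rewrite nuE.
    have -> : tens1 phi (a *: m) = phi a *: tens1 phi m.
      exact: (linearZ_LR (base_change_unit phi M)).
    rewrite (tens1E (phi := phi) m ((a, e) : RA)).
    have -> : triv_injr e = ((a, e) : R) - phi a.
      by congr pair; rewrite /= ?subrr ?subr0.
    exact: scalerBl.
  exists (t + t'); rewrite linearD tE t'E (linearD nu).
  have -> : tens1 phi ((nu n : M) + nu n') = tens1 phi (nu n : M) + tens1 phi (nu n' : M).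
    exact: (linearD (base_change_unit phi M)).
  by rewrite opprD addrACA.
have -> : tens1 phi (nu n : M) = 0 by rewrite nu0; exact: (linear0 (base_change_unit phi M)).
by rewrite subr0.
Qed.

End BaseChange.

Lemma sgp_of_base_change_triv_ext (M : lmodType A) :
  strongly_gorenstein_projective (base_change phi M) ->
  strongly_gorenstein_projective M.
Proof.
move=> /sgpP[P [i [p [Pp [iI pS ip] iQ]]]].
have [nu [nu1 nu0]] := base_change_collapse M.
pose I : {linear M -> triv_coker P} :=
  postcomp _ (triv_coker_proj P) (postcomp _ (restrict_lin phi i) (base_change_unit phi M)).
have IE m : I m = triv_coker_proj P (i (tens1 phi m)) by [].
(* As [i] sends [EN] into [EP], it induces a map on quotients, and this map is [I]. *)
have I_nu n : triv_coker_proj P (i n) = I (nu n).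
  apply/eqP; rewrite -subr_eq0 IE -(linearB (triv_coker_proj P)) -linearB.
  have [|t <-] := (nu0 (n - tens1 phi (nu n : M))).1.
    by rewrite linearB nu1 subrr.
  by apply/eqP/triv_coker_proj_eq0; exists (tensor_map i ER t); rewrite triv_mul_map_nat.
have [q qE] := triv_coker_lift (postcomp _ nu p).
apply/sgpP; exists (triv_coker P), I, q; split.
- exact: projective_triv_coker.
- split.
  + apply: linear_inj => m /triv_coker_proj_eq0[t tE].
    (* The product of [t] is [i (m (x) 1)], which [p] kills; multiplication on [N (x) E] being
       injective, [p (x) E] already kills [t]. *)
    have [s sE] : exists s, tensor_map i ER s = t.
      apply/(tensor_map_exact pS ip); apply: triv_mul_map_inj.
      rewrite linear0 -triv_mul_map_nat tE.
      by apply/ip; exists (tens1 phi m).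
    rewrite -(nu1 m); apply/nu0; exists s.
    by apply: iI; rewrite triv_mul_map_nat sE tE.
  + move=> m; have [x xE] := pS (tens1 phi m).
    by exists (triv_coker_proj P x); rewrite qE /= xE nu1.
  + move=> v; have [x <-] := quot_proj_surj v.
    rewrite -/(triv_coker_proj P x) qE /=; split=> [/nu0[t tE]|[m]].
      (* Since [p x] lies in [EN] and [EP] maps onto [EN], an element of [EP] can be subtracted from
         [x] to land in the kernel of [p]. *)
      have [s sE] := tensor_map_surj pS t.
      have [n nE] : exists n, i n = x - triv_mul_map P s.
        by apply/ip; rewrite linearB triv_mul_map_nat sE tE subrr.
      exists (nu n); apply: etrans (esym (I_nu n)) _; rewrite nE (linearB (triv_coker_proj P)).
      rewrite (_ : triv_coker_proj P (triv_mul_map P s) = 0) ?subr0//.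
      by apply/triv_coker_proj_eq0; exists s.
    move=> Im; have /triv_coker_proj_eq0[t tE] :
        triv_coker_proj P (x - i (tens1 phi m)) = 0.
      by apply/eqP; rewrite (linearB (triv_coker_proj P)) subr_eq0; apply/eqP/esym.
    have -> : x = triv_mul_map P t + i (tens1 phi m) by rewrite tE subrK.
    rewrite linearD (_ : p (i _) = 0) ?addr0; last by apply/ip; eexists.
    exact: (triv_mul_map_kill (postcomp _ nu p)).
move=> Q h Qp.
(* The base change of [h] extends to [P]; collapsing its target to [Q] makes the extension factor
   through [P/EP]. *)
have [g gE] := iQ _ (base_change_map phi h) (projective_base_change (phi := phi) Qp).
have [nuQ [nuQ1 _]] := base_change_collapse Q.
have [g' g'E] := triv_coker_lift (postcomp _ nuQ g).
exists g' => m; rewrite IE g'E /= gE /tens1.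
by rewrite base_change_mapE; exact: nuQ1.
Qed.

End Descent.

(** * Coinduced modules, as right adjoint to restriction *)

Section Coinduced.
Variables (A R : comPzRingType) (phi : {rmorphism A -> R}).
Local Notation RA := (restrict phi R^o).

Lemma coinduced_lift (X : lmodType R) (I : lmodType A)
    (j : {linear restrict phi X -> I}) :
  exists k : {linear X -> coinduced phi I},
    forall x (s : RA), (k x : {linear RA -> I}) s = j ((s : R) *: (x : X)).
Proof.
have fL (x : X) : linear (fun s : RA => j ((s : R) *: x)).
  move=> a s s'; rewrite scalerDl [_ *: s]restrict_scaleE -scalerA.
  exact: (linearP j).
have FL : linear (fun x : X => mklin (fL x) : coinduced phi I).
  move=> r x y; apply: linear_ext => s.
  rewrite lin_addE coinduced_scaleE /= scalerDr scalerA [_ * r]mulrC.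
  exact: (linearD j).
by exists (mklin FL).
Qed.

Lemma coinduced_eval (X : lmodType R) (I : lmodType A)
    (f : {linear X -> coinduced phi I}) :
  exists g : {linear restrict phi X -> I},
    forall x, g x = (f x : {linear RA -> I}) (1 : R).
Proof.
have evL : linear (fun x : restrict phi X => (f x : {linear RA -> I}) (1 : R)).
  move=> a x y; rewrite restrict_scaleE (linearD f) linearZ_LR lin_addE.
  by congr (_ + _); exact: (linearZ_LR (f x : {linear RA -> I})).
by exists (mklin evL).
Qed.

Lemma coinduced_eval_scale (X : lmodType R) (I : lmodType A)
    (f : {linear X -> coinduced phi I}) x (s : RA) :
  (f ((s : R) *: x) : {linear RA -> I}) (1 : R) = (f x : {linear RA -> I}) s.
Proof. by rewrite linearZ_LR coinduced_scaleE mulr1. Qed.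

(** Coinduction is right adjoint to restriction, which preserves injections. *)
Lemma injective_coinduced (I : lmodType A) :
  injective_module I -> injective_module (coinduced phi I).
Proof.
move=> Ii X Y u f uI.
have [f' f'E] := coinduced_eval f.
have [g gE] := Ii _ _ (restrict_lin phi u) f' uI.
have [k kE] := coinduced_lift g.
exists k => x; apply: linear_ext => s.
rewrite [LHS]kE -linearZ_LR; apply: etrans (gE _) _.
by rewrite f'E coinduced_eval_scale.
Qed.

End Coinduced.

(** * Divisible groups are injective, and every module embeds into an injective one *)

Lemma int_ideal_principal (J : int -> Prop) : J 0 ->
  (forall a x y, J x -> J y -> J (a * x + y)) ->
  exists n0, J n0 /\ forall n, J n -> exists k, n = k * n0.
Proof.
move=> J0 JL.
have [pos|none] := pselect (exists m : nat, `[< J m.+1 >]); last first.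
  have JN n : J n -> J (- n) by move=> Jn; rewrite -mulN1r -[_ * _]addr0; exact: JL.
  exists 0; split=> // n Jn; exists 0; rewrite mul0r.
  case: n Jn => [[//|n]|n] Jn; case: none; exists n; apply/asboolP => //.
  by have := JN _ Jn; rewrite NegzE opprK.
(* The minimum is taken over predecessors, so the generator is [m.+1]; division by it leaves a
   remainder in [J] that minimality forces to be zero. *)
pose m := ex_minn pos.
have [Jm mmin] : J m.+1 /\ forall n : nat, J n.+1 -> (m <= n)%N.
  rewrite /m; case: ex_minnP => k /asboolP Jk kmin; split=> // n Jn.
  by apply: kmin; apply/asboolP.
exists m.+1; split=> // n Jn; exists (n %/ m.+1)%Z.
have Jr : J (n %% m.+1)%Z.
  have := JL (- (n %/ m.+1)%Z) _ _ Jm Jn.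
  by rewrite {2}(divz_eq n m.+1) mulNr addKr.
have : (n %% m.+1)%Z < m.+1 by exact: ltz_pmod.
have : 0 <= (n %% m.+1)%Z by exact: modz_ge0.
rewrite {3}(divz_eq n m.+1).
case: (n %% m.+1)%Z Jr => // -[_|r Jr _]; first by rewrite addr0.
by rewrite ltz_nat ltnS ltnNge mmin.
Qed.

Section DivisibleInjective.
Variable D : lmodType int.
Hypothesis Ddiv : forall (n : int) (d : D), n != 0 -> exists e, n *: e = d.
Variables (X Y : lmodType int) (u : {linear X -> Y}) (f : {linear X -> D}).
Hypothesis uI : injective u.

(* Graphs of partial linear maps [Y -> D] extending [f] along [u]. *)
Definition partial_ext (G : set (Y * D)) : Prop :=
  [/\ forall x, G (u x, f x),
      forall (a : int) v w, G v -> G w -> G (a *: v + w) &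
      forall d, G (0, d) -> d = 0].

(** The multiples of [y] already in the domain form an ideal [n0 Z]; dividing the value at [n0 y] by
    [n0] gives a consistent value at [y]. *)
Lemma partial_ext_adjoin (G : set (Y * D)) (y : Y) : partial_ext G ->
  exists G', [/\ partial_ext G', (G `<=` G')%classic & exists d, G' (y, d)].
Proof.
move=> [Gf GL G0].
have G00 : G 0 by have := Gf 0; rewrite !linear0.
have GZ a v : G v -> G (a *: v) by move=> Gv; rewrite -[_ *: _]addr0; exact: GL.
have GB v w : G v -> G w -> G (w - v).
  by move=> Gv Gw; rewrite addrC -scaleN1r; exact: GL.
have [||n0 [[v0 Gv0] n0P]] := @int_ideal_principal (fun n => exists v, G (n *: y, v)).
- by exists 0; rewrite scale0r.
- move=> a m n [v Gv] [w Gw]; exists (a *: v + w).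
  by rewrite scalerDl -scalerA; exact: (GL a _ _ Gv Gw).
have [d dE] : exists d, n0 *: d = v0.
  (* If [n0 = 0], the prescribed value is zero and [0] may be assigned to [y]. *)
  have [n00|/Ddiv//] := eqVneq n0 0.
  exists 0; rewrite scaler0; apply/esym/G0.
  by rewrite n00 scale0r in Gv0.
exists (fun v => exists2 w, G w & exists k : int, v = k *: (y, d) + w); split.
- split.
  + by move=> x; exists (u x, f x) => //; exists 0; rewrite scale0r add0r.
  + move=> a _ _ [w Gw [k ->]] [w' Gw' [k' ->]].
    exists (a *: w + w'); first exact: GL.
    by exists (a * k + k'); rewrite scalerDr addrACA scalerA scalerDl.
  + move=> d' [[y1 d1] Gw [k [/esym y1E ->]]].
    have {}y1E : y1 = (- k) *: y by rewrite scaleNr; apply/eqP; rewrite -addr_eq0 addrC y1E.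
    have [k' kE] : exists k', - k = k' * n0 by apply: n0P; exists d1; rewrite -y1E.
    have := GB _ _ (GZ k' _ Gv0) Gw.
    rewrite (_ : _ - _ = (0, d1 - k' *: v0)); last first.
      by congr pair; rewrite /= y1E kE scalerA subrr.
    move/G0 => /eqP; rewrite subr_eq0 => /eqP ->.
    by rewrite -dE scalerA -kE scaleNr subrr.
- by move=> w Gw; exists w => //; exists 0; rewrite scale0r add0r.
- by exists d, 0 => //; exists 1; rewrite scale1r addr0.
Qed.

Lemma partial_ext_total : exists2 G, partial_ext G & forall y, exists d, G (y, d).
Proof.
pose G0 : set (Y * D) := fun v => exists x, v = (u x, f x).
have G0L (a : int) v w : G0 v -> G0 w -> G0 (a *: v + w).
  by move=> [x ->] [x' ->]; exists (a *: x + x'); rewrite !linearP.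
(* The graph [G0] is adjoined inside the predicate so that the empty chain, whose union is empty,
   also satisfies it. *)
have [|G [PG Gmax]] := @Zorn_bigcup _ [set G | partial_ext (G0 `|` G)]%classic.
  move=> F FP Ftot; split=> [x|a v w|d].
  - by left; exists x.
  - have H B t : F B -> (G0 `|` B)%classic t -> (G0 `|` \bigcup_(B in F) B)%classic t.
      by move=> FB [?|Bt]; [left|right; exists B].
    have K B : F B -> (G0 `|` B)%classic v -> (G0 `|` B)%classic w ->
        (G0 `|` \bigcup_(B in F) B)%classic (a *: v + w).
      by move=> FB Bv Bw; apply: (H B) => //; have [_ BL _] := FP _ FB; exact: BL.
    move=> [v0|[B FB Bv]] [w0|[C FC Cw]].
    + by left; exact: G0L.
    + by apply: (K C) => //; [left|right].
    + by apply: (K B) => //; [right|left].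
    + have [BC|CB] := Ftot _ _ FB FC.
      * by apply: (K C) => //; right => //; exact: BC.
      * by apply: (K B) => //; right => //; exact: CB.
  - move=> [[x [x0 ->]]|[B FB Bd]]; last by have [_ _] := FP _ FB; apply; right.
    (* Injectivity of [u] is what makes [G0] single-valued. *)
    by rewrite (uI (etrans (esym x0) (esym (linear0 u)))) linear0.
exists (G0 `|` G)%classic => // y.
have [G' [PG' GG' [d Gd]]] := partial_ext_adjoin y PG.
exists d; right; apply: contrapT => nGd.
apply: (Gmax G').
  split=> [t Gt|/(_ _ Gd)//]; by apply: GG'; right.
rewrite /= (_ : (G0 `|` G')%classic = G')//.
apply/seteqP; split=> [t [[x ->]|//]|t]; last by right.
by have [] := PG'.
Qed.

Lemma injective_divisible_ext : exists g : {linear Y -> D}, g \o u =1 f.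
Proof.
have [G [Gf GL G0] /choice[g gG]] := partial_ext_total.
have Guniq y d d' : G (y, d) -> G (y, d') -> d = d'.
  move=> Gd Gd'; have := GL (-1) _ _ Gd' Gd.
  rewrite (_ : _ + _ = (0, d - d')).
    by move/G0/eqP; rewrite subr_eq0 => /eqP.
  by congr pair; rewrite /= scaleN1r ?addNr// addrC.
have gL : linear g.
  by move=> a y y'; apply: Guniq (gG _) _; exact: (GL a _ _ (gG y) (gG y')).
exists (mklin gL) => x.
exact: Guniq (gG _) (Gf x).
Qed.

End DivisibleInjective.

Lemma injective_divisible (D : lmodType int) :
  (forall (n : int) (d : D), n != 0 -> exists e, n *: e = d) -> injective_module D.
Proof. by move=> Ddiv X Y u f uI; exact: injective_divisible_ext. Qed.

(* Writing [G = Z^(G) / K] with [K] the relations, [G] embeds into [Q^(G) / K]. *)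
Lemma enough_injectives_int (G : lmodType int) :
  exists (D : lmodType int) (g : {linear G -> D}), injective_module D /\ injective g.
Proof.
pose phi : {rmorphism int -> rat} := intmul 1.
pose W : lmodType int := restrict phi (freemod rat G).
pose j : {linear freemod int G -> W} := free_lift (fun x : G => free_gen rat x : W).
(* On coordinates [j] is the inclusion of [int] into [rat], whence its injectivity. *)
have jE v x : free_coef (j v : freemod rat G) x = (free_coef v x)%:~R.
  have cL : linear (fun w : W => free_coef (w : freemod rat G) x : restrict phi rat^o).
    by move=> a w w'; rewrite free_coef_linear.
  have dL : linear (fun v : freemod int G => (free_coef v x)%:~R : restrict phi rat^o).
    by move=> a w w'; rewrite free_coef_linear rmorphD rmorphM.
  apply: (@free_ext _ _ _ (precomp _ j (mklin cL)) (mklin dL)) => y.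
  rewrite /= free_lift_gen /free_coef /=.
  by rewrite (rmorph_nat phi).
have jI : injective j.
  move=> v w vw; apply: val_inj; apply/funext => x.
  by apply: (@intr_inj rat); rewrite -[LHS]jE -[RHS]jE vw.
pose S := im (postcomp _ j (submod_incl (ker (free_cover G)))).
have [g gE] : exists g : {linear G -> quotmod S},
    forall v, g (free_cover G v) = quot_proj S (j v).
  apply: (@factor_surj _ _ _ _ _ (postcomp _ (quot_proj S) j) (@free_cover_surj _ G)).
  move=> v v0; apply/quot_proj_eq0/asboolP.
  have vK : v \in ker (free_cover G) by rewrite inE; apply/eqP.
  by exists (submod_elt vK).
exists (quotmod S), g; split.
  apply: injective_divisible => n d n0; have [w <-] := quot_proj_surj d.
  exists (quot_proj S ((n%:~R^-1 : rat) *: (w : freemod rat G) : W)).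
  rewrite -linearZ_LR; congr quot_proj.
  by rewrite restrict_scaleE scalerA mulfV ?scale1r// intr_eq0.
apply: linear_inj => z; have [v <-] := free_cover_surj z.
rewrite gE => /quot_proj_eq0/asboolP[[k kK] /jI <-].
by apply/eqP; exact: kK.
Qed.

(** The underlying abelian group embeds into an injective one, which is then coinduced to [A];
    evaluation at [1] recovers the embedding. *)
Lemma enough_injectives (A : comPzRingType) (X : lmodType A) :
  exists (I : lmodType A) (g : {linear X -> I}), injective_module I /\ injective g.
Proof.
pose phi : {rmorphism int -> A} := intmul 1.
have [D [j [Di jI]]] := enough_injectives_int (restrict phi X).
have [k kE] := coinduced_lift j.
exists (coinduced phi D), k; split; first exact: injective_coinduced.
move=> x y xy; apply: jI.
have := kE x (1 : A); have := kE y (1 : A).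
by rewrite !scale1r xy => -> ->.
Qed.

(** * Vanishing of Ext for a module that is its own cosyzygy *)

Section LiftsThrough.
Variables (A : comPzRingType) (M I : lmodType A).
Variables (i : {linear M -> I}) (p : {linear I -> M}).
Hypotheses (Ii : injective_module I) (ses : short_exact i p).

(** For a short exact sequence [M -> I -> M] with [I] injective, this is the vanishing of
    [Ext^1(L, M)]. *)
Definition lifts_through (L : lmodType A) : Prop :=
  forall h : {linear L -> M}, exists g : {linear L -> I}, forall x, p (g x) = h x.

(* As [M] is its own cosyzygy, the obstruction [Ext^1(L, M)] equals
   [Ext^2(K, M) = Ext^1(K, M)]. *)
Lemma lifts_through_ker (L F K : lmodType A) (j : {linear L -> F})
    (q : {linear F -> K}) :
  short_exact j q -> lifts_through F -> lifts_through K -> lifts_through L.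
Proof.
move=> [jI qS jq] FL KL h; have [iI pS ip] := ses.
have [k kE] : exists k : {linear F -> I}, forall x, k (j x) = i (h x).
  by have [k kE] := Ii (postcomp _ i h) jI; exists k.
have [k' k'E] : exists k' : {linear K -> M}, forall v, k' (q v) = p (k v).
  apply: (factor_surj (h := postcomp _ p k) qS) => _ /jq[x <-] /=.
  by rewrite kE; apply/ip; exists (h x).
have [g gE] := KL k'.
(* Subtracting a lift of [k'] brings [k] into the image of [M]; the correction vanishes on [L]. *)
have [l lE] : exists l : {linear F -> M}, forall v, i (l v) = k v - g (q v).
  apply: (factor_inj (h := k - precomp _ q g) iI) => v; apply/ip.
  by rewrite lin_addE linearD /= linearN gE k'E subrr.
have [l' l'E] := FL l.
exists (postcomp _ l' j) => x /=; rewrite l'E.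
have qj0 : q (j x) = 0 by apply/jq; exists x.
apply: iI; rewrite lE kE qj0.
by rewrite linear0 subr0.
Qed.

(** [Hom(-, J)] turns a finite flat resolution of [X] into a finite injective coresolution of
    [Hom(X, J)], along which one shifts dimension. *)
Lemma lifts_through_hom (J X : lmodType A) :
  (forall L : lmodType A, injective_module L -> lifts_through L) ->
  injective_module J -> finite_fd X -> lifts_through {linear X -> J}.
Proof.
move=> IL Ji [n [C [Cf Cn]]].
apply: (resolution_ind (cl := @flat A) (K := fun X => lifts_through {linear X -> J}))
  Cf Cn => [Z Z0 h|U F Y j q [jI qS jq] Ff UL].
  exists \0 => f; rewrite (_ : f = 0) ?linear0//.
  by apply: linear_ext => z; rewrite (Z0 z) linear0.
apply: (@lifts_through_ker _ _ _ (precomp J q) (precomp J j)) _ UL.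
  split=> [f g fg|f|f].
  - apply: linear_ext => y; have [x <-] := qS y.
    exact: (congr1 (fun k : {linear F -> J} => k x) fg).
  - by have [g gE] := Ji _ _ _ f jI; exists g; apply: linear_ext.
  - split=> [f0|[g <-]]; last first.
      apply: linear_ext => u /=; rewrite (_ : q (j u) = 0) ?linear0//.
      by apply/jq; exists u.
    have [g gE] : exists g : {linear Y -> J}, forall v, g (q v) = f v.
      apply: factor_surj => // v /jq[u <-].
      exact: (congr1 (fun k : {linear U -> J} => k u) f0).
    by exists g; apply: linear_ext.
exact/IL/injective_hom_flat.
Qed.

(** A lift [k] of [h] over the free cover fails to descend to [X] by a cocycle [c] with values in
    [M]; writing [c] as the coboundary of [b] corrects [k]. *)
Lemma lifts_through_Ext1 (X : lmodType A) :
  is_zero (Ext 1 X M) -> lifts_through X.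
Proof.
move=> X0 h; have [iI pS ip] := ses.
pose C := free_resolution X.
have augS := @res_aug_surj _ _ C.
have /exact_atP aug0 := @res_exact0 _ _ C.
have /exact_atP d0 := @res_exact _ _ C 0%N.
have [k kE] : exists k : {linear C 0%N -> I}, forall x, p (k x) = h (res_aug C x).
  by have [k kE] := freemod_projective (precomp _ (res_aug C) h) pS; exists k.
have [c cE] : exists c : {linear C 1%N -> M}, forall x, i (c x) = k (res_diff C 0%N x).
  apply: (factor_inj (h := precomp _ (res_diff C 0%N) k) iI) => x; apply/ip.
  rewrite /= kE (_ : res_aug C _ = 0) ?linear0//.
  by apply/aug0; exists x.
have c0 x : c (res_diff C 1%N x) = 0.
  have dd0 : res_diff C 0%N (res_diff C 1%N x) = 0 by apply/d0; exists x.
  by apply: iI; rewrite cE dd0 2!linear0.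
have cK : c \in ker (precomp M (res_diff C 1%N)).
  by apply/eqP/linear_ext => x; exact: c0.
have /quot_proj_eq0/asboolP[b bE] := X0 (quot_proj _ (submod_elt cK)).
have {}bE x : b (res_diff C 0%N x) = c x.
  exact: (congr1 (fun k : {linear C 1%N -> M} => k x) bE).
have [g gE] : exists g : {linear X -> I}, forall x, g (res_aug C x) = k x - i (b x).
  apply: (factor_surj (h := k - postcomp _ i b) augS) => _ /aug0[y <-].
  by rewrite lin_addE /= bE cE subrr.
exists g => y; have [x <-] := augS y.
rewrite gE linearB kE (_ : p (i _) = 0) ?subr0//.
by apply/ip; exists (b x).
Qed.

End LiftsThrough.

(** * Strong Gorenstein injectivity of coinduced modules, and the theorem *)

Lemma sgi_coinduced (A R : comPzRingType) (phi : {rmorphism A -> R}) (M : lmodType A) :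
  is_zero (Ext 1 (restrict phi R^o) M) -> finite_fd (restrict phi R^o) ->
  strongly_gorenstein_injective M -> strongly_gorenstein_injective (coinduced phi M).
Proof.
pose RA : lmodType A := restrict phi R^o.
move=> Ext0 Rfd /sgiP[I [i [p [Ii ses pJ]]]]; have [iI pS ip] := ses.
have mapL (U V : lmodType A) (u : {linear U -> V}) :
    linear (postcomp RA u : coinduced phi U -> coinduced phi V).
  by move=> r f g; apply: linear_ext => s; exact: (linearD u).
apply/sgiP; exists (coinduced phi I), (mklin (mapL _ _ i)), (mklin (mapL _ _ p)).
split; first exact: injective_coinduced.
  split=> [f g fg|f|f].
  - apply: linear_ext => s; apply: iI.
    exact: (congr1 (fun k : {linear RA -> I} => k s) fg).
  - have [g gE] := lifts_through_Ext1 ses Ext0 f.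
    by exists g; apply: linear_ext.
  - split=> [f0|[g <-]]; last first.
      by apply: linear_ext => s; apply/ip; exists ((g : {linear RA -> M}) s).
    have [g gE] := factor_inj (h := f : {linear RA -> I}) iI (fun s => (ip _).1
      (congr1 (fun k : {linear RA -> M} => k s) f0)).
    by exists g; apply: linear_ext.
move=> J h Ji.
(* An [A]-embedding of [J] into [I'] transposes to an [R]-embedding of [J] into the coinduced
   module, which splits as [J] is injective. *)
have [I' [e [I'i eI]]] := enough_injectives (restrict phi J).
have [k kE] := coinduced_lift e.
have kI : injective k.
  move=> x y xy; apply: eI.
  have := kE x (1 : R); have := kE y (1 : R).
  by rewrite !scale1r xy => -> ->.
have [r rK] := Ji _ _ k idfun kI.
have [h' h'E] := coinduced_eval h.
(* The pointwise [A]-action and the one through [phi] agree because the functions are [A]-linear. *)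
have scaleE a (f : {linear RA -> I'}) : a *: f = (phi a *: (f : coinduced phi I')).
  by apply: linear_ext => s; rewrite lin_scaleE -linearZ_LR.
have rL : linear (fun f : {linear RA -> I'} => h' (r (f : coinduced phi I'))).
  by move=> a f g; rewrite scaleE (linearP r) (linearD h') -(linearZ_LR h').
(* By adjunction it is enough to lift [h'] through [p] over [A]; the lift is found on all of
   [Hom_A(R, I')], then restricted to [J] along [k]. *)
have [G GE] := lifts_through_hom Ii ses (fun L Li h => pJ L h Li) I'i Rfd (mklin rL).
have gL : linear (fun x : restrict phi J => G (k x : {linear RA -> I'})).
  by move=> a x y; rewrite -linearP scaleE -linearP.
have [g gE] := coinduced_lift (mklin gL).
exists g => x; apply: linear_ext => s.
apply: etrans (congr1 p (gE x s)) _; rewrite /= GE /=.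
have -> : r (k ((s : R) *: x)) = (s : R) *: x by exact: rK.
by rewrite h'E coinduced_eval_scale.
Qed.

Theorem theorem2p1 (A : comPzRingType) (E M : lmodType A) :
  (finite_pd E ->
   strongly_gorenstein_projective M ->
   strongly_gorenstein_projective (base_change (triv_incl E) M)) /\
  (flat E ->
   strongly_gorenstein_projective (base_change (triv_incl E) M) ->
   strongly_gorenstein_projective M) /\
  ((forall p : nat, (1 <= p)%N ->
      is_zero (Ext p (restrict (triv_incl E) (triv_ext E)^o) M)) ->
   finite_fd (restrict (triv_incl E) (triv_ext E)^o) ->
   strongly_gorenstein_injective M ->
   strongly_gorenstein_injective (coinduced (triv_incl E) M)).
Proof.
split; first exact: sgp_base_change_triv_ext.
split; first by move=> _; exact: sgp_of_base_change_triv_ext.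
by move=> /(_ 1%N isT) Ext0; exact: sgi_coinduced.
Qed.
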